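(* Let $T$ be NIP with monster model $\mathbb{M}$, and let $G = G(x)$ be an $A$-type-definable group. Then there is an $A$-type-definable set $\mathrm{St}_{G} \subseteq G \times \widetilde{\mathcal{M}}_G$ so that for any $[\mu] \in \widetilde{\mathcal{M}}_G$ we have $\mathrm{St}_{G}(\mathbb{M};[\mu]) = \mathrm{Stab}_{G}(\mu)$. Similarly, there is an $A$-type-definable set $\mathrm{St}_{G}^{\leftrightarrow} \subseteq G \times \widetilde{\mathcal{M}}_G$ so that for any $[\mu] \in \widetilde{\mathcal{M}}_G$ we have $\mathrm{St}^{\leftrightarrow}_{G}(\mathbb{M};[\mu]) = \mathrm{Stab}^{\leftrightarrow}_{G}(\mu)$.
   Context: $\mathfrak{M}_G(\mathbb{M})$ is the set of global Keisler measures (finitely additive probability measures on definable-with-parameters subsets of $\mathbb{M}^x$) supported on $G$, i.e. giving measure $1$ to every formula in the partial type defining $G$. For $g\in G(\mathbb{M})$, $(g\cdot\mu)(\varphi(x)):=\mu(\varphi(g\cdot x))$, and $\mu\cdot g$ is defined analogously by right translation; $\mathrm{Stab}_G(\mu)=\{g\in G(\mathbb{M}):g\cdot\mu=\mu\}$ and $\mathrm{Stab}^{\leftrightarrow}_G(\mu)=\{g\in G(\mathbb{M}):g\cdot\mu=\mu\cdot g=\mu\}$. In an NIP theory, $\mu$ is generically stable if for some small model $M$ it is definable over $M$ ($M$-invariant with $\mathrm{tp}(b/M)\mapsto\mu(\varphi(x,b))$ continuous on $S_y(M)$ for all $\varphi$) and finitely satisfiable in $M$ (every formula of positive measure is realized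 in $M$). Coding of generically stable measures. For $\bar{a}=(a_1,\dots,a_n)$, $\mathrm{Av}(\bar{a};\varphi(x,b)):=\frac1n|\{i:\models\varphi(a_i,b)\}|$. By NIP there are numbers $n_{\varphi,\varepsilon}$, for $\varphi(x,y)\in L$ and $\varepsilon>0$, so that every generically stable $\mu$ has an $\varepsilon$-approximation on $\varphi$ (i.e. $\bar{a}$ with $|\mathrm{Av}(\bar{a};\varphi(x,b))-\mu(\varphi(x,b))|\le\varepsilon$ for all $b$) of length exactly $n_{\varphi,\varepsilon}$; fix these. Let $X_x$ be the $\emptyset$-type-definable set of tuples $\bar{a}=(\bar{a}_{\varphi,1/k}:\varphi(x,y)\in L,k\ge1)$, $\bar{a}_{\varphi,1/k}\in(\mathbb{M}^x)^{n_{\varphi,1/k}}$, such that (i) $|\mathrm{Av}(\bar{a}_{\varphi,1/k_1};\varphi(x,b))-\mathrm{Av}(\bar{a}_{\varphi,1/k_2};\varphi(x,b))|\le2/k$ for all $\varphi$, $k$, $k_1,k_2\ge k$ and $b$; and (ii) for all $\varphi_1,\varphi_2,k,b_1,b_2$ with $\varphi_1(x,b_1)\wedge\varphi_2(x,b_2)$ inconsistent, $\mathrm{Av}(\bar{a}_{\varphi_1\vee\varphi_2,1/k};\varphi_1(x,b_1)\vee\varphi_2(x,b_2))$ differs from $\mathrm{Av}(\bar{a}_{\varphi_1,1/k};\varphi_1(x,b_1))+\mathrm{Av}(\bar{a}_{\varphi_2,1/k};\varphi_2(x,b_2))$ by at most $3/k$. For $\bar{a}\in X_x$, $\mu_{\bar{a}}(\varphi(x,b)):=\lim_k\mathrm{Av}(\bar{a}_{\varphi,1/k};\varphi(x,b))$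 is a generically stable measure. $E_x(\bar{a},\bar{a}')$ holds iff $|\mathrm{Av}(\bar{a}_{\varphi,1/k};\varphi(x,b))-\mathrm{Av}(\bar{a}'_{\varphi,1/k};\varphi(x,b))|\le4/k$ for all $\varphi,k,b$; on $X_x$ this is a type-definable equivalence relation, holding iff $\mu_{\bar{a}}=\mu_{\bar{a}'}$. $\widetilde{\mathcal{M}}_x:=X_x/E_x$; for generically stable $\mu$, $[\mu]$ is the unique class $\bar{a}/E_x$ with $\mu_{\bar{a}}=\mu$; $\mu\mapsto[\mu]$ is a bijection between generically stable measures in $x$ and $\widetilde{\mathcal{M}}_x$. $\widetilde{\mathcal{M}}_G$ is the ($A$-type-definable) set of all $[\mu]\in\widetilde{\mathcal{M}}_x$ with $\mu\in\mathfrak{M}_G(\mathbb{M})$. A subset of $G\times\widetilde{\mathcal{M}}_G$ is $A$-type-definable if its preimage among representatives is $A$-type-definable; $\mathrm{St}_G(\mathbb{M};[\mu])$ denotes its fiber $\{g\in G(\mathbb{M}):(g,[\mu])\in\mathrm{St}_G\}$. *)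

(* Defs.v *)
From HB Require Import structures.
From mathcomp Require Import all_boot all_order all_algebra.
From mathcomp Require Import all_classical all_reals all_analysis.
Set Implicit Arguments.
Unset Strict Implicit.
Unset Printing Implicit Defensive.
Import Order.TTheory GRing.Theory Num.Theory.
Import numFieldNormedType.Exports.
Local Open Scope classical_set_scope.
Local Open Scope ring_scope.

(** * First-order logic *)

Record language := Language {
  fsym : Type;
  farity : fsym -> nat;
  rsym : Type;
  rarity : rsym -> nat }.

Inductive term (L : language) (V : Type) : Type :=
| Var of V
| App (f : fsym L) of ('I_(farity f) -> term L V).

(* Formulas with free variables in an arbitrary type V; a quantifier binds the
   extra variable None of [option V]. Parameters are treated as additional
   variables that are later assigned their own value. *)
Inductive formula (L : language) (V : Type) : Type :=
| Eq of term L V & term L V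
| Rel (r : rsym L) of ('I_(rarity r) -> term L V)
| Not of formula L V
| Or of formula L V & formula L V
| Ex of formula L (option V).

Fixpoint tmap (L : language) (V W : Type) (h : V -> W) (t : term L V) :
    term L W :=
  match t with
  | Var v => Var L (h v)
  | App f args => App (f := f) (fun i => tmap h (args i))
  end.

Fixpoint fmap (L : language) (V W : Type) (h : V -> W) (phi : formula L V) :
    formula L W :=
  match phi with
  | Eq s t => Eq (tmap h s) (tmap h t)
  | Rel r args => Rel (r := r) (fun i => tmap h (args i))
  | Not psi => Not (fmap h psi)
  | Or psi1 psi2 => Or (fmap h psi1) (fmap h psi2)
  | Ex psi => Ex (fmap (omap h) psi)
  end.

Record structure (L : language) := Structure {
  dom :> Type;
  dom_inhabited : inhabited dom;
  finterp : forall f : fsym L, ('I_(farity f) -> dom) -> dom;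
  rinterp : forall r : rsym L, ('I_(rarity r) -> dom) -> Prop }.

Arguments finterp {L s} f _.
Arguments rinterp {L s} r _.

Fixpoint eval (L : language) (M : structure L) (V : Type) (v : V -> M)
    (t : term L V) : M :=
  match t with
  | Var x => v x
  | App f args => finterp f (fun i => eval v (args i))
  end.

Fixpoint sat (L : language) (M : structure L) (V : Type) (v : V -> M)
    (phi : formula L V) : Prop :=
  match phi with
  | Eq s t => eval v s = eval v t
  | Rel r args => rinterp r (fun i => eval v (args i))
  | Not psi => ~ sat v psi
  | Or psi1 psi2 => sat v psi1 \/ sat v psi2
  | Ex psi => exists d : M, sat (oapp v d) psi
  end.

Definition sentence (L : language) := formula L void.

Definition model (L : language) (T : set (sentence L)) (M : structure L) :=
  forall s, T s -> sat (M := M) (of_void M) s.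

Definition entails (L : language) (T : set (sentence L)) (s : sentence L) :=
  forall M : structure L, model T M -> sat (M := M) (of_void M) s.

Definition complete_theory (L : language) (T : set (sentence L)) :=
  (exists M : structure L, model T M) /\
  (forall s, entails T s \/ entails T (Not s)).

Definition env (V W : Type) (M : Type) (v : V -> M) (w : W -> M) :
    V + W -> M :=
  fun z => match z with inl x => v x | inr y => w y end.

(* phi(x, y) with x the fixed n-tuple of variables, y a finite tuple *)
Record pformula (L : language) (n : nat) := PFormula {
  ysize : nat;
  body : formula L ('I_n + 'I_ysize) }.

Definition defset (L : language) (M : structure L) (n : nat)
    (phi : pformula L n) (b : 'I_(ysize phi) -> M) : set ('I_n -> M) :=
  [set a | sat (env a b) (body phi)].

Arguments defset {L M n} phi b.

(* phi1(x, y1) \/ phi2(x, y2), with y1 and y2 disjoint tuples of variables *)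
Definition por (L : language) (n : nat) (phi1 phi2 : pformula L n) :
    pformula L n :=
  PFormula
    (Or (fmap (fun z : 'I_n + 'I_(ysize phi1) =>
                match z with
                | inl i => inl i
                | inr j => inr (lshift (ysize phi2) j)
                end) (body phi1))
        (fmap (fun z : 'I_n + 'I_(ysize phi2) =>
                match z with
                | inl i => inl i
                | inr j => inr (rshift (ysize phi1) j)
                end) (body phi2))).

Definition joint (D : Type) (m1 m2 : nat) (b1 : 'I_m1 -> D)
    (b2 : 'I_m2 -> D) : 'I_(m1 + m2) -> D :=
  fun j => match fintype.split j with inl j1 => b1 j1 | inr j2 => b2 j2 end.

Definition definable (L : language) (M : structure L) (n : nat)
    (D : set ('I_n -> M)) :=
  exists phi : pformula L n, exists b, D = defset phi b.

(** * NIP *)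

Definition shattered (L : language) (M : structure L) (n : nat)
    (phi : pformula L n) (S : set ('I_n -> M)) :=
  forall I : set ('I_n -> M), I `<=` S ->
    exists b : 'I_(ysize phi) -> M,
      forall a, S a -> (defset phi b a <-> I a).

Definition NIP (L : language) (T : set (sentence L)) :=
  forall (M : structure L), model T M ->
  forall (n : nat) (phi : pformula L n) (S : set ('I_n -> M)),
    shattered phi S -> finite_set S.

(** * Monster models

   A cardinal kappa is represented by a type K with kappa elements. *)

(* |C| < kappa *)
Definition small (K U : Type) (C : set U) := ~ ([set: K] #<= C)%card.

(* the solutions in M of a partial type with parameters in C *)
Definition realizations (L : language) (M : structure L) (V : Type)
    (C : set M) (p : set (formula L (V + C))) : set (V -> M) :=
  [set v | forall phi, p phi -> sat (env v set_val) phi].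

Definition complete_type (L : language) (M : structure L) (C : set M)
    (m : nat) (p : set (formula L ('I_m + C))) :=
  (forall F, finite_set F -> F `<=` p -> realizations F !=set0) /\
  (forall phi, p phi \/ p (Not phi)).

(* the space S_y(C) of complete types over C, y an m-tuple *)
Record types (L : language) (M : structure L) (C : set M) (m : nat) := Types {
  type_set : set (formula L ('I_m + C));
  type_complete : complete_type type_set }.

HB.instance Definition _ (L : language) (M : structure L) (C : set M)
  (m : nat) := gen_eqMixin (types C m).
HB.instance Definition _ (L : language) (M : structure L) (C : set M)
  (m : nat) := gen_choiceMixin (types C m).
HB.instance Definition _ (L : language) (M : structure L) (C : set M)
  (m : nat) := isSubBaseTopological.Build (types C m)
    (range (fun theta : formula L ('I_m + C) =>
              [set p : types C m | type_set p theta])) id.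

Definition saturated (K : Type) (L : language) (M : structure L) :=
  forall (C : set M) (m : nat) (p : types C m),
    small K C -> realizations (type_set p) !=set0.

Definition elementary_on (L : language) (N M : structure L) (C : set N)
    (f : N -> M) :=
  forall (m : nat) (phi : formula L 'I_m) (v : 'I_m -> N),
    (forall i, C (v i)) -> (sat v phi <-> sat (f \o v) phi).

Definition automorphism (L : language) (M : structure L) (s : M -> M) :=
  [/\ bijective s,
      forall (f : fsym L) (v : 'I_(farity f) -> M),
        s (finterp f v) = finterp f (s \o v)
    & forall (r : rsym L) (v : 'I_(rarity r) -> M),
        rinterp r v <-> rinterp r (s \o v)].

Definition strongly_homogeneous (K : Type) (L : language) (M : structure L) :=
  forall (C : set M) (f : M -> M), small K C -> elementary_on C f ->
    exists s : M -> M, automorphism s /\ forall x, C x -> s x = f x.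

(* kappa > |L| + aleph_0, the number of L-formulas *)
Definition monster (K : Type) (L : language) (T : set (sentence L))
    (M : structure L) :=
  [/\ model T M, small K [set: formula L nat], saturated K M
    & strongly_homogeneous K M].

(* C is the underlying set of a small elementary substructure of M *)
Definition small_model (K : Type) (L : language) (M : structure L)
    (C : set M) :=
  small K C /\
  exists (N : structure L) (f : N -> M), elementary_on setT f /\ C = range f.

(** * Type-definable sets and groups *)

Definition type_definable (L : language) (M : structure L) (A : set M)
    (V : Type) (S : set (V -> M)) :=
  exists p : set (formula L (V + A)), S = realizations p.

(* [mul] makes the set G of solutions of pG a group; the values of [mul]
   outside of G are irrelevant. *)
Definition type_definable_group (L : language) (M : structure L) (A : set M)
    (n : nat) (pG : set (formula L ('I_n + A)))
    (mul : ('I_n -> M) -> ('I_n -> M) -> ('I_n -> M)) :=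
  let G := realizations pG in
  [/\ forall g h, G g -> G h -> G (mul g h),
      forall g h k, G g -> G h -> G k -> mul g (mul h k) = mul (mul g h) k,
      exists e, [/\ G e, forall g, G g -> mul e g = g /\ mul g e = g
        & forall g, G g -> exists h, [/\ G h, mul g h = e & mul h g = e]]
    & type_definable A [set v : 'I_n + ('I_n + 'I_n) -> M |
        let g := v \o inl in
        let h := v \o (inr \o inl) in
        let k := v \o (inr \o inr) in
        [/\ G g, G h & k = mul g h]]].

(** * Keisler measures

   A measure is a function on all sets whose values matter only on the
   definable ones. *)

Definition keisler (R : realType) (L : language) (M : structure L) (n : nat)
    (mu : set ('I_n -> M) -> R) :=
  [/\ forall D, definable D -> 0 <= mu D,
      mu setT = 1
    & forall D1 D2, definable D1 -> definable D2 -> D1 `&` D2 = set0 ->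
        mu (D1 `|` D2) = mu D1 + mu D2].

Definition same_measure (R : realType) (L : language) (M : structure L)
    (n : nat) (mu nu : set ('I_n -> M) -> R) :=
  forall D, definable D -> mu D = nu D.

(* mu is supported on the set defined by the partial type pG *)
Definition supported (R : realType) (L : language) (M : structure L)
    (A : set M) (n : nat) (pG : set (formula L ('I_n + A)))
    (mu : set ('I_n -> M) -> R) :=
  forall theta, pG theta ->
    mu [set a | sat (env a set_val) theta] = 1.

(* The function induced on S_y(C) is well-defined (that is, mu is C-invariant)
   and continuous. *)
Definition definable_over (R : realType) (L : language) (M : structure L)
    (n : nat) (C : set M) (mu : set ('I_n -> M) -> R) :=
  forall phi : pformula L n, exists2 F : types C (ysize phi) -> R,
    continuous F &
    forall b p, realizations (type_set p) b -> F p = mu (defset phi b).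

Definition finsat_in (R : realType) (L : language) (M : structure L)
    (n : nat) (C : set M) (mu : set ('I_n -> M) -> R) :=
  forall D, definable D -> 0 < mu D ->
    exists a : 'I_n -> M, (forall i, C (a i)) /\ D a.

Definition generically_stable (K : Type) (R : realType) (L : language)
    (M : structure L) (n : nat) (mu : set ('I_n -> M) -> R) :=
  keisler mu /\
  exists C : set M, [/\ small_model K C, definable_over C mu
    & finsat_in C mu].

(** * Translates and stabilizers *)

(* For mu supported on G, the measure of a relatively definable subset S of G:
   the value at any definable D with D /\ G = S (by saturation, it does not
   depend on D). *)
Definition relative_measure (R : realType) (L : language) (M : structure L)
    (n : nat) (G : set ('I_n -> M)) (mu : set ('I_n -> M) -> R)
    (S : set ('I_n -> M)) : R :=
  mu (xget set0 [set D | definable D /\ D `&` G = S]).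

(* g . mu, where (g . mu)(phi(x)) = mu(phi(g . x)) *)
Definition ltranslate (R : realType) (L : language) (M : structure L)
    (n : nat) (G : set ('I_n -> M))
    (mul : ('I_n -> M) -> ('I_n -> M) -> ('I_n -> M)) (g : 'I_n -> M)
    (mu : set ('I_n -> M) -> R) : set ('I_n -> M) -> R :=
  fun D => relative_measure G mu [set x | G x /\ D (mul g x)].

Definition rtranslate (R : realType) (L : language) (M : structure L)
    (n : nat) (G : set ('I_n -> M))
    (mul : ('I_n -> M) -> ('I_n -> M) -> ('I_n -> M)) (g : 'I_n -> M)
    (mu : set ('I_n -> M) -> R) : set ('I_n -> M) -> R :=
  fun D => relative_measure G mu [set x | G x /\ D (mul x g)].

Definition stab (R : realType) (L : language) (M : structure L) (n : nat)
    (G : set ('I_n -> M)) (mul : ('I_n -> M) -> ('I_n -> M) -> ('I_n -> M))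
    (mu : set ('I_n -> M) -> R) : set ('I_n -> M) :=
  [set g | G g /\ same_measure (ltranslate G mul g mu) mu].

Definition stab2 (R : realType) (L : language) (M : structure L) (n : nat)
    (G : set ('I_n -> M)) (mul : ('I_n -> M) -> ('I_n -> M) -> ('I_n -> M))
    (mu : set ('I_n -> M) -> R) : set ('I_n -> M) :=
  [set g | [/\ G g, same_measure (ltranslate G mul g mu) mu
             & same_measure (rtranslate G mul g mu) mu]].

(** * Coding of generically stable measures *)

Definition Av (R : realType) (U : Type) (l : nat) (a : 'I_l -> U)
    (D : set U) : R :=
  #|[pred i | `[< D (a i) >]]|%:R / l%:R.

(* N phi eps is the length n_{phi, eps} of the chosen approximations. *)
Definition approx_lengths (K : Type) (R : realType) (L : language)
    (M : structure L) (n : nat) (N : pformula L n -> R -> nat) :=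
  forall (phi : pformula L n) (eps : R), 0 < eps ->
    (0 < N phi eps)%N /\
    forall mu : set ('I_n -> M) -> R, generically_stable K mu ->
      exists a : 'I_(N phi eps) -> 'I_n -> M,
        forall b, `|Av R a (defset phi b) - mu (defset phi b)| <= eps.

(* Here and below the index k stands for k + 1 in the usual numbering by
   k >= 1, so that [inv_k k] runs through 1, 1/2, 1/3, ... *)
Definition inv_k (R : realType) (k : nat) : R := k.+1%:R^-1.

(* The coordinates, with values in M, of a tuple
   (a_{phi, 1/k} : phi, k) with a_{phi, 1/k} in (M^n)^(n_{phi, 1/k}) *)
Definition code_index (R : realType) (L : language) (n : nat)
    (N : pformula L n -> R -> nat) :=
  {q : pformula L n * nat & ('I_(N q.1 (inv_k R q.2)) * 'I_n)%type}.

Definition approx (R : realType) (L : language) (M : Type) (n : nat)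
    (N : pformula L n -> R -> nat) (a : code_index N -> M) (phi : pformula L n)
    (k : nat) : 'I_(N phi (inv_k R k)) -> 'I_n -> M :=
  fun i j => a (existT _ (phi, k) (i, j)).

Arguments approx {R L M n N} a phi k.

Definition codes (R : realType) (L : language) (M : structure L) (n : nat)
    (N : pformula L n -> R -> nat) : set (code_index N -> M) :=
  [set a |
    (forall (phi : pformula L n) (k k1 k2 : nat) b,
       (k <= k1)%N -> (k <= k2)%N ->
       `|Av R (approx a phi k1) (defset phi b) -
         Av R (approx a phi k2) (defset phi b)| <= 2 * inv_k R k) /\
    (forall (phi1 phi2 : pformula L n) (k : nat) b1 b2,
       defset phi1 b1 `&` defset phi2 b2 = set0 :> set ('I_n -> M) ->
       `|Av R (approx a (por phi1 phi2) k)
              (defset (por phi1 phi2) (joint b1 b2)) -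
         (Av R (approx a phi1 k) (defset phi1 b1) +
          Av R (approx a phi2 k) (defset phi2 b2))| <= 3 * inv_k R k)].

Definition code_equiv (R : realType) (L : language) (M : structure L)
    (n : nat) (N : pformula L n -> R -> nat) (a a' : code_index N -> M) :=
  forall (phi : pformula L n) (k : nat) b,
    `|Av R (approx a phi k) (defset phi b) -
      Av R (approx a' phi k) (defset phi b)| <= 4 * inv_k R k.

(* the class of a in the quotient X / E of [codes] by [code_equiv] *)
Definition code_class (R : realType) (L : language) (M : structure L)
    (n : nat) (N : pformula L n -> R -> nat) (a : code_index N -> M) :
    set (code_index N -> M) :=
  [set a' | codes a' /\ code_equiv a a'].

(* mu_a = mu, as measures *)
Definition represents (R : realType) (L : language) (M : structure L)
    (n : nat) (N : pformula L n -> R -> nat) (a : code_index N -> M)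
    (mu : set ('I_n -> M) -> R) :=
  forall (phi : pformula L n) b,
    (fun k => Av R (approx a phi k) (defset phi b)) @ \oo
      --> mu (defset phi b).

(* [mu] : the unique class of X / E whose members represent mu *)
Definition measure_code (R : realType) (L : language) (M : structure L)
    (n : nat) (N : pformula L n -> R -> nat) (mu : set ('I_n -> M) -> R) :
    set (code_index N -> M) :=
  xget set0 [set c | exists2 a, codes a /\ represents a mu &
                                c = code_class a].

Arguments measure_code {R L M n} N mu.

(* the codes [mu] of generically stable measures supported on G *)
Definition group_codes (K : Type) (R : realType) (L : language)
    (M : structure L) (A : set M) (n : nat) (N : pformula L n -> R -> nat)
    (pG : set (formula L ('I_n + A))) : set (set (code_index N -> M)) :=
  [set c | exists mu : set ('I_n -> M) -> R,
     [/\ generically_stable K mu, supported pG mu & c = measure_code N mu]].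

Arguments group_codes K {R L M A n} N pG.

(* A-type-definability of a set of pairs (g, a/E), through representatives *)
Definition code_type_definable (R : realType) (L : language)
    (M : structure L) (A : set M) (n : nat) (N : pformula L n -> R -> nat)
    (S : set (('I_n -> M) * set (code_index N -> M))) :=
  type_definable A [set v : 'I_n + code_index N -> M |
    codes (v \o inr) /\ S (v \o inl, code_class (v \o inr))].

(* Main.v *)
From Pilot Require Import Defs.
From HB Require Import structures.
From mathcomp Require Import all_boot all_order all_algebra.
From mathcomp Require Import finmap lra.
From mathcomp Require Import all_classical all_reals all_analysis.
Set Implicit Arguments.
Unset Strict Implicit.
Unset Printing Implicit Defensive.
Import Order.TTheory GRing.Theory Num.Theory.
Import numFieldNormedType.Exports.
Import Pilot.Defs.
Local Open Scope classical_set_scope.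
Local Open Scope ring_scope.

(** The point of the coding is that the value of a measure becomes visible to
    finitely many coordinates of a code: if a code a represents mu, then the
    average of the a_{phi, 1/k} over phi(x, b) is within 2/k of mu(phi(x, b)).
    Hence mu(phi(x, b)) = mu(psi(x, c)) holds if and only if, for every k, the
    two averages differ by at most 4/k ([code_value_eq_dist]), and similarly
    mu(phi(x, b)) = r if and only if every average is within 2/k of r.  An
    average takes finitely many values and each of them is attained on a
    definable set ([simple_fun_Av]), so conditions of this kind, also after
    quantifying over b, are given by one formula for each phi and k.

    To say in this way that g stabilizes mu, the translate phi(g . x, b) must be
    an instance of a formula that depends on phi alone.  Multiplication is only
    type-definable, but its graph contains at most one point over each (g, x),
    and by compactness some single formula gamma(g, x, z) implied by its type
    already defines a partial function; on G that function is multiplication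
    ([op_graph_formula]).  So phi(g . x, b) is equivalent on G to the existence
    of z with gamma(g, x, z) and phi(z, b) ([op_translate]).  A measure supported
    on G cannot distinguish definable sets with the same trace on G, again by
    compactness ([supported_eq]), so g . mu may be computed with this formula.
    The set St is then cut out, among pairs (g, a), by: a is a code, mu_a is
    supported on G, g is in G, and the averages for phi(g . x, b) and phi(x, b)
    are 4/k-close for all phi, k and b.  Right translation is the same argument
    for the opposite multiplication, and the two-sided stabilizer is an
    intersection.

    What remains is that every code does come from a generically stable measure,
    for otherwise the conditions above would admit too many codes.  The limit of
    the averages is independent of the formula defining a set, because a formula
    and a negation of an equivalent one have limits summing to 1
    ([code_value_setC]); this gives a Keisler measure [code_measure].  It is
    finitely satisfiable in, and definable over, any small set that contains the
    coordinates of the code, and such a set can be taken to be an elementary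
    submodel, by a Skolem hull ([small_model_containing]). *)

(** * Renaming and finite support of formulas *)

Lemma eval_tmap (L : language) (M : structure L) (V W : Type) (h : V -> W)
    (v : W -> M) (t : term L V) : eval v (tmap h t) = eval (v \o h) t.
Proof.
elim: t => [x|f args IH] //=; congr finterp; apply/funext => i; exact: IH.
Qed.

Lemma oapp_omap (V W D : Type) (h : V -> W) (v : W -> D) (d : D) :
  oapp v d \o omap h = oapp (v \o h) d.
Proof. by apply/funext => -[]. Qed.

Lemma sat_fmap (L : language) (M : structure L) (V : Type)
    (phi : formula L V) : forall (W : Type) (h : V -> W) (v : W -> M),
  sat v (fmap h phi) <-> sat (v \o h) phi.
Proof.
elim: phi => {V} [V s t|V r args|V psi IH|V psi1 IH1 psi2 IH2|V psi IH] W h v /=.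
- by rewrite !eval_tmap.
- suff -> : (fun i => eval v (tmap h (args i))) =
            (fun i => eval (v \o h) (args i)) by [].
  by apply/funext => i; rewrite eval_tmap.
- by rewrite IH.
- by rewrite IH1 IH2.
- by split=> -[d Hd]; exists d; move: Hd; rewrite IH oapp_omap.
Qed.

Lemma dependent_choice_fun (I : Type) (B : I -> Type)
    (P : forall i, B i -> Prop) :
  (forall i, exists y, P i y) -> exists f : forall i, B i, forall i, P i (f i).
Proof.
by move=> H; exists (fun i => projT1 (cid (H i))) => i; case: cid.
Qed.

Lemma term_finite_support (L : language) (V : Type) (t : term L V) :
  forall (X Y : Type) (h : V -> X + Y),
  exists (I : finType) (be : I -> Y) (u : term L (X + I)),
  forall (M : structure L) (v : X -> M) (w : Y -> M),
    eval (env v w \o h) t = eval (env v (w \o be)) u.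
Proof.
move=> X Y h; elim: t => [x|f args IH].
  case hx: (h x) => [x'|y].
    exists void, (fun i : void => match i with end), (Var L (inl x')).
    by move=> M v w /=; rewrite hx.
  exists unit, (fun=> y), (Var L (inr tt)).
  by move=> M v w /=; rewrite hx.
have [I {}IH] := dependent_choice_fun IH.
have [be {}IH] := dependent_choice_fun IH.
have [u {}IH] := dependent_choice_fun IH.
exists {i : 'I_(farity f) & I i}, (fun z => be (tag z) (tagged z)).
exists (App (f := f) (fun i => tmap
  (fun z : X + I i =>
     match z with inl x => inl x | inr j => inr (existT _ i j) end) (u i))).
move=> M v w /=; congr finterp; apply/funext => i.
rewrite IH eval_tmap; congr eval.
by apply/funext => -[].
Qed.

(** The renaming h presents the free variables as a sum X + Y; only those in Y
    are collected into a finite type.  Keeping X arbitrary lets the induction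
    pass under a quantifier, whose bound variable joins X. *)
Lemma formula_finite_support (L : language) (V : Type) (phi : formula L V) :
  forall (X Y : Type) (h : V -> X + Y),
  exists (I : finType) (be : I -> Y) (psi : formula L (X + I)),
  forall (M : structure L) (v : X -> M) (w : Y -> M),
    sat (env v w \o h) phi <-> sat (env v (w \o be)) psi.
Proof.
elim: phi => {V} [V s t|V r args|V phi IH|V phi1 IH1 phi2 IH2|V phi IH] X Y h.
- have [I [be [u Hu]]] := term_finite_support s h.
  have [J [be' [u' Hu']]] := term_finite_support t h.
  exists (I + J)%type, (fun z => match z with inl i => be i | inr j => be' j end).
  exists (Eq
    (tmap (fun z => match z with inl x => inl x | inr i => inr (inl i) end) u)
    (tmap (fun z => match z with inl x => inl x | inr i => inr (inr i) end) u')).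
  move=> M v w /=; rewrite Hu Hu' !eval_tmap.
  set c := env _ _ \o _; have -> : c = env v (w \o be) by apply/funext => -[].
  by set d := env _ _ \o _; have -> : d = env v (w \o be') by apply/funext => -[].
- have [I IH] := dependent_choice_fun (fun i => term_finite_support (args i) h).
  have [be {}IH] := dependent_choice_fun IH.
  have [u {}IH] := dependent_choice_fun IH.
  exists {i : 'I_(rarity r) & I i}, (fun z => be (tag z) (tagged z)).
  exists (Rel (r := r) (fun i => tmap
    (fun z : X + I i =>
       match z with inl x => inl x | inr j => inr (existT _ i j) end) (u i))).
  move=> M v w /=.
  set f1 := (fun i => _); set f2 := (fun i => _).
  suff -> : f1 = f2 by [].
  apply/funext => i; rewrite /f1 /f2 IH eval_tmap; congr eval.
  by apply/funext => -[].
- have [I [be [psi H]]] := IH X Y h.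
  by exists I, be, (Not psi) => M v w /=; rewrite H.
- have [I [be [psi1 H1]]] := IH1 X Y h.
  have [J [be' [psi2 H2]]] := IH2 X Y h.
  exists (I + J)%type, (fun z => match z with inl i => be i | inr j => be' j end).
  exists (Or
   (fmap (fun z => match z with inl x => inl x | inr i => inr (inl i) end) psi1)
   (fmap (fun z => match z with inl x => inl x | inr i => inr (inr i) end) psi2)).
  move=> M v w /=; rewrite H1 H2 !sat_fmap.
  set c := env _ _ \o _; have -> : c = env v (w \o be) by apply/funext => -[].
  by set d := env _ _ \o _; have -> : d = env v (w \o be') by apply/funext => -[].
- have [I [be [psi H]]] := IH (option X) Y
   (fun o => match o with
     | None => inl None
     | Some x => match h x with inl x => inl (Some x) | inr y => inr y end end).
  exists I, be, (Ex (fmap (fun z => match z with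
     | inl None => None | inl (Some x) => Some (inl x)
     | inr i => Some (inr i) end) psi)).
  move=> M v w /=; split=> -[d Hd]; exists d.
    rewrite sat_fmap.
    set f := _ \o _; have -> : f = env (oapp v d) (w \o be).
      by apply/funext => -[[]|].
    apply/H; move: Hd; congr sat.
    by apply/funext => -[x|] //=; case: (h x).
  move: Hd; rewrite sat_fmap.
  set f := _ \o _; have -> : f = env (oapp v d) (w \o be).
    by apply/funext => -[[]|].
  move=> /H; congr sat.
  by apply/funext => -[x|] //=; case: (h x).
Qed.

(** * Sets defined by one formula *)

Definition definable_with (L : language) (M : structure L) (A : set M)
    (V : Type) (S : set (V -> M)) :=
  exists phi : formula L (V + A), forall v, S v <-> sat (env v set_val) phi.

Section DefinableWith.
Context (L : language) (M : structure L) (A : set M).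

Lemma definable_with_ext (V : Type) (S S' : set (V -> M)) :
  (forall v, S v <-> S' v) -> definable_with A S -> definable_with A S'.
Proof. by move=> SS' [phi H]; exists phi => v; rewrite -SS'. Qed.

Lemma definable_with_not (V : Type) (S : set (V -> M)) :
  definable_with A S -> definable_with A [set v : V -> M | ~ S v].
Proof. by case=> phi H; exists (Not phi) => v /=; rewrite H. Qed.

Lemma definable_with_or (V : Type) (S S' : set (V -> M)) :
  definable_with A S -> definable_with A S' ->
  definable_with A [set v : V -> M | S v \/ S' v].
Proof.
by case=> phi H [phi' H']; exists (Or phi phi') => v /=; rewrite H H'.
Qed.

Lemma definable_with_and (V : Type) (S S' : set (V -> M)) :
  definable_with A S -> definable_with A S' ->
  definable_with A [set v : V -> M | S v /\ S' v].
Proof.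
move=> /definable_with_not H /definable_with_not H'.
apply: (definable_with_ext _ (definable_with_not (definable_with_or H H'))) => v.
by rewrite /= not_orP !notK.
Qed.

Lemma definable_with_imp (V : Type) (S S' : set (V -> M)) :
  definable_with A S -> definable_with A S' ->
  definable_with A [set v : V -> M | S v -> S' v].
Proof.
move=> /definable_with_not H H'.
by apply: (definable_with_ext _ (definable_with_or H H')) => v; rewrite /= implyE.
Qed.

Lemma definable_with_iff (V : Type) (S S' : set (V -> M)) :
  definable_with A S -> definable_with A S' ->
  definable_with A [set v : V -> M | S v <-> S' v].
Proof.
by move=> H H'; apply: definable_with_and; apply: definable_with_imp.
Qed.

Lemma definable_with_sat (V W : Type) (phi : formula L W) (h : W -> V + A) :
  definable_with A [set v : V -> M | sat (env v set_val \o h) phi].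
Proof. by exists (fmap h phi) => v; rewrite sat_fmap. Qed.

Lemma definable_with_comp (V W : Type) (S : set (W -> M)) (h : W -> V + A) :
  definable_with A S -> definable_with A [set v : V -> M | S (env v set_val \o h)].
Proof.
case=> phi H.
have := definable_with_sat phi (fun z : W + A =>
   match z with inl w => h w | inr a => inr a end).
apply: definable_with_ext => v /=; rewrite H; split; congr sat;
 by apply/funext => -[].
Qed.

Lemma definable_with_reindex (V W : Type) (S : set (W -> M)) (h : W -> V) :
  definable_with A S -> definable_with A [set v : V -> M | S (v \o h)].
Proof. by move=> /(definable_with_comp (inl \o h)). Qed.

Lemma definable_with_eq (V : Type) (x y : V) :
  definable_with A [set v : V -> M | v x = v y].
Proof. by exists (Eq (Var L (inl x)) (Var L (inl y))). Qed.

Lemma definable_with_const (V : Type) (P : Prop) :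
  definable_with A [set v : V -> M | P].
Proof.
have [d0] := dom_inhabited M.
pose phi : formula L (V + A) := Ex (Eq (Var L None) (Var L None)).
have [HP|HP] := pselect P; last exists (Not phi) => v /=; first exists phi => v /=.
  by split=> // _; exists d0.
by split=> // -[]; exists d0.
Qed.

(** Stands for a finite union; the index type is only an eqType so that it can
    be a set of real values. *)
Lemma definable_with_exists_in (T : eqType) (V : Type) (s : seq T)
    (S : T -> set (V -> M)) :
  (forall r, definable_with A (S r)) ->
  definable_with A [set v : V -> M | exists2 r, r \in s & S r v].
Proof.
move=> HS; elim: s => [|r s IH].
  apply: definable_with_ext (definable_with_const V False) => v /=.
  by split=> // -[].
apply: definable_with_ext (definable_with_or (HS r) IH) => v /=; split.
  by case=> [Sr|[t ts St]]; [exists r|exists t]; rewrite ?mem_head // inE ts orbT.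
by move=> [t]; rewrite inE => /orP[/eqP->|ts] St; [left|right; exists t].
Qed.

Lemma definable_with_forall_fin (I : finType) (V : Type)
    (S : I -> set (V -> M)) :
  (forall i, definable_with A (S i)) ->
  definable_with A [set v : V -> M | forall i, S i v].
Proof.
move=> HS.
have := definable_with_exists_in (enum I) (fun i => definable_with_not (HS i)).
move=> /definable_with_not; apply: definable_with_ext => v /=; split.
  by move=> H i; apply: contrapT => Si; apply: H; exists i; rewrite ?mem_enum.
by move=> H [i _].
Qed.

Lemma definable_with_exists1 (V : Type) (S : set (option V -> M)) :
  definable_with A S -> definable_with A [set v : V -> M | exists d, S (oapp v d)].
Proof.
case=> phi H; exists (Ex (fmap (fun z => match z with
   | inl (Some x) => Some (inl x) | inl None => None
   | inr a => Some (inr a) end) phi)) => v /=.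
split=> -[d Hd]; exists d; move: Hd; rewrite H sat_fmap; congr sat;
  by apply/funext => -[[]|].
Qed.

Lemma definable_with_exists (V : Type) (m : nat) (S : set (V + 'I_m -> M)) :
  definable_with A S ->
  definable_with A [set v : V -> M | exists b : 'I_m -> M, S (env v b)].
Proof.
elim: m V S => [|m IH] V S HS.
  have h0 : 'I_0 -> V by case.
  have := definable_with_reindex
    (fun z : V + 'I_0 => match z with inl x => x | inr i => h0 i end) HS.
  have E v b : v \o (fun z : V + 'I_0 => match z with inl x => x | inr i => h0 i end)
     = env v b by apply/funext => -[|[]].
  apply: definable_with_ext => v /=; split.
    have b : 'I_0 -> M by case.
    by rewrite (E _ _ b); exists b.
  by case=> b; rewrite (E _ _ b).
pose h (z : V + 'I_m.+1) : option V + 'I_m :=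
  match z with
  | inl x => inl (Some x)
  | inr i => if unlift ord0 i is Some j then inr j else inl None end.
have := definable_with_exists1 (IH _ _ (definable_with_reindex h HS)).
apply: definable_with_ext => v /=; split.
  case=> d [b HS']; exists (fun i => if unlift ord0 i is Some j then b j else d).
  move: HS'; congr S; apply/funext => -[x|i] //=.
  by case: (unlift ord0 i).
case=> b HS'; exists (b ord0), (fun j => b (lift ord0 j)).
move: HS'; congr S; apply/funext => -[x|i] //=.
by case: unliftP => [j ->|->].
Qed.

Lemma definable_with_forall (V : Type) (m : nat) (S : set (V + 'I_m -> M)) :
  definable_with A S ->
  definable_with A [set v : V -> M | forall b : 'I_m -> M, S (env v b)].
Proof.
move=> /definable_with_not/definable_with_exists/definable_with_not.
apply: definable_with_ext => v /=; split; last by move=> H [b].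
by move=> H b; apply: contrapT => Sb; apply: H; exists b.
Qed.

Lemma definable_with_sub (B : set M) (V : Type) (S : set (V -> M)) :
  A `<=` B -> definable_with A S -> definable_with B S.
Proof.
move=> AB [phi H].
exists (fmap (fun z : V + A => match z with inl x => inl x
   | inr a => inr (SigSub (mem_set (AB _ (set_valP a)))) end) phi) => v.
by rewrite H sat_fmap; split; congr sat; apply/funext => -[].
Qed.

(** Finitely many of the variables in W and of the parameters occur in the
    formula: they become the tuple y of a formula in the format phi(x, y) in
    which codes and measures are stated, and the family of fibers over W
    becomes a family of instances of that one formula. *)
Lemma definable_with_pformula (n : nat) (W : Type) (S : set ('I_n + W -> M)) :
  definable_with A S ->
  exists (phi : pformula L n) (h : 'I_(ysize phi) -> W + A),
    forall x w, S (env x w) <-> defset phi (env w set_val \o h) x.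
Proof.
case=> psi H.
have [I [be [psi0 H0]]] := formula_finite_support psi (fun z : ('I_n + W) + A =>
  match z with inl (inl i) => inl i | inl (inr w) => inr (inl w)
             | inr a => inr (inr a) end).
exists (PFormula (fmap (fun z : 'I_n + I => match z with inl i => inl i
   | inr j => inr (enum_rank j) end) psi0)) => /=.
exists (be \o enum_val) => x w.
rewrite H /defset /= sat_fmap.
have -> : env x (env w set_val \o (be \o enum_val)) \o (fun z : 'I_n + I =>
   match z with inl i => inl i | inr j => inr (enum_rank j) end) =
   env x (env w set_val \o be).
  by apply/funext => -[i|j] //=; rewrite enum_rankK.
rewrite -H0; split; congr sat; by apply/funext => -[[]|].
Qed.

(** * Functions with finitely many values and definable fibers *)

Definition simple_fun (R V : Type) (f : (V -> M) -> R) :=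
  (exists s : seq {classic R}, forall v, (f v : {classic R}) \in s) /\
  forall r, definable_with A [set v : V -> M | f v = r].

Lemma simple_fun_rel (R R' V : Type) (f : (V -> M) -> R) (g : (V -> M) -> R')
    (Q : R -> R' -> Prop) :
  simple_fun f -> simple_fun g -> definable_with A [set v : V -> M | Q (f v) (g v)].
Proof.
move=> [[s Hs] Hf] [[t Ht] Hg].
have := @definable_with_exists_in {classic R} V s
  (fun r => [set v : V -> M | f v = r /\ exists2 u : {classic R'}, u \in t &
                 g v = u /\ Q r u]) _.
move=> H; apply: definable_with_ext (H _) => {H} [v|r] /=.
  split; first by case=> r _ [-> [u _ [-> ]]].
  by move=> Hq; exists (f v) => //; split=> //; exists (g v).
apply: definable_with_and; first exact: Hf.
have H u : definable_with A [set v : V -> M | g v = u /\ Q r u].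
  apply: definable_with_and; first exact: Hg.
  exact: (definable_with_const V (Q r u)).
exact: (@definable_with_exists_in {classic R'} V t _ H).
Qed.

Lemma simple_fun_op (R1 R2 R3 V : Type) (f : (V -> M) -> R1)
    (g : (V -> M) -> R2) (op : R1 -> R2 -> R3) :
  simple_fun f -> simple_fun g -> simple_fun (fun v => op (f v) (g v)).
Proof.
move=> Hf Hg; split; last by move=> r; apply: (simple_fun_rel (fun x y => op x y = r)).
move: Hf Hg => [[s Hs] _] [[t Ht] _].
exists (@allpairs _ _ {classic R3} op s t) => v.
exact: (@allpairs_f {classic R1} {classic R2} {classic R3} op).
Qed.

(** A function of the truth values of finitely many formulas is simple: a fiber
    is the union of the finitely many truth patterns that h sends to the given
    value, each of them a finite conjunction. *)
Lemma simple_fun_pattern (R V : Type) (I : finType) (P : I -> set (V -> M))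
    (h : {ffun I -> bool} -> R) :
  (forall i, definable_with A (P i)) ->
  simple_fun (fun v => h [ffun i => `[< P i v >]]).
Proof.
move=> HP; split.
  exists (@map _ {classic R} h (enum {ffun I -> bool})) => v.
  by apply: (@map_f _ {classic R} h); rewrite mem_enum.
move=> r.
have := @definable_with_exists_in _ V (enum {ffun I -> bool})
  (fun f => [set v : V -> M | h f = r /\ forall i, P i v <-> f i]) _.
move=> H; apply: definable_with_ext (H _) => {H} [v|f] /=.
  split.
    case=> f _ [<- Hi]; congr h; apply/ffunP => i; rewrite ffunE.
    by apply/asboolP/idP => /Hi.
  move=> E; exists [ffun i => `[< P i v >]]; rewrite ?mem_enum //; split=> // i.
  by rewrite ffunE; split => /asboolP.
apply: definable_with_and; first exact: (definable_with_const V (h f = r)).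
apply: (@definable_with_forall_fin I V (fun i => [set v | P i v <-> f i])) => i.
apply: definable_with_iff; first exact: HP.
exact: (definable_with_const V (f i)).
Qed.

(** The points of the tuple and the parameters of phi may each be variables or
    elements of A, so that the same lemma serves when the code varies and when
    it is fixed inside a model. *)
Lemma simple_fun_Av (R : realType) (V : Type) (n l : nat) (phi : pformula L n)
    (al : 'I_l -> 'I_n -> V + A) (be : 'I_(ysize phi) -> V + A) :
  simple_fun (fun v : V -> M => Av R (fun i => env v set_val \o al i)
                (defset phi (env v set_val \o be))).
Proof.
have := @simple_fun_pattern R V _
  (fun i : 'I_l => [set v : V -> M | defset phi (env v set_val \o be)
       (env v set_val \o al i)])
  (fun f => #|[pred i | f i]|%:R / l%:R) _.
rewrite (_ : (fun v : V -> M => _) = (fun v : V -> M => Av R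
   (fun i => env v set_val \o al i) (defset phi (env v set_val \o be)))).
  apply=> i.
  have := definable_with_sat (body phi)
     (fun z => match z with inl x => al i x | inr y => be y end).
  by apply: definable_with_ext => v; rewrite /defset /=; split; congr sat;
     apply/funext => -[].
apply/funext => v; rewrite /Av; congr (_%:R / _); apply: eq_card => i.
by rewrite !inE ffunE.
Qed.

End DefinableWith.
(** * Small sets *)

(** A countable subset of A is large enough to absorb F, and the rest of A stays
    fixed. *)
Lemma card_setU_finite (T : Type) (A F : set T) :
  infinite_set A -> finite_set F -> (A `|` F #<= A)%card.
Proof.
elim/Ppointed: T => T in A F *.
  by rewrite emptyE => infA; exfalso; apply: infA; exact: finite_set0.
move=> /infiniteP/card_subP[B Bnat BA] finF.
have : (B `|` F #<= B)%card.
  rewrite (card_le_eqr Bnat).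
  have -> : B `|` F = \bigcup_(b in [set: bool]) (if b then B else F).
    apply/seteqP; split=> x; first by case=> Hx; [exists true|exists false].
    by case=> -[] _ Hx; [left|right].
  apply: bigcup_countable => // -[] _; last exact: finite_set_countable.
  by rewrite /countable (card_le_eql Bnat).
move=> /pcard_leP/injfunPex[f fB finj].
pose h x := if x \in B `|` F then f x else x.
have hA : h @` (A `|` F) `<=` A.
  move=> _ [x AFx <-]; rewrite /h; case: ifPn.
    by rewrite inE => BFx; apply/BA/fB.
  move=> /negP; rewrite inE => nBF.
  by case: AFx => // Fx; exfalso; apply: nBF; right.
apply: card_le_trans (subset_card_le hA).
rewrite (card_le_eqr (inj_card_eq _)) // => x y _ _; rewrite /h.
case: ifPn => Bx; case: ifPn => By //.
- by move=> E; apply: finj.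
- move=> E; move: By; rewrite -E => /negP; rewrite inE; case; left.
  by apply: fB; rewrite inE in Bx.
- move=> E; move: Bx; rewrite E => /negP; rewrite inE; case; left.
  by apply: fB; rewrite inE in By.
Qed.

Lemma formula_infinite (L : language) : ([set: nat] #<= [set: formula L nat])%card.
Proof.
pose f (i : nat) : formula L nat := Eq (Var L i) (Var L i).
apply: card_le_trans (card_leT (range f)).
by rewrite (card_le_eqr (inj_card_eq _)) // => i j _ _ [].
Qed.

Lemma small_setU_finite (K : Type) (L : language) (T : Type) (A F : set T) :
  small K [set: formula L nat] -> small K A -> finite_set F ->
  small K (A `|` F).
Proof.
move=> KL KA finF KAF.
have infK : infinite_set [set: K].
  move=> finK; apply: KL; apply: card_le_trans (formula_infinite L).
  exact: finite_set_countable.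
have [finA|infA] := pselect (finite_set A).
  by apply: infK; apply: card_le_finite KAF _; rewrite finite_setU.
by apply: KA; apply: card_le_trans KAF (card_setU_finite infA finF).
Qed.

(** * Compactness *)

(** Saturation speaks of complete types, so the directed family is first
    extended to an ultrafilter; the formulas whose solution sets belong to the
    ultrafilter form a complete type, and a realization of it lies in every
    member of the family. *)
Lemma saturated_ord_directed (K : Type) (L : language) (M : structure L)
    (A : set M) (m : nat) (F : set (set ('I_m -> M))) :
  saturated K M -> small K A -> F !=set0 ->
  (forall S, F S -> definable_with A S /\ S !=set0) ->
  (forall S1 S2, F S1 -> F S2 -> exists2 S3, F S3 & S3 `<=` S1 `&` S2) ->
  exists v, forall S, F S -> S v.
Proof.
move=> satM KA F0 FS Fdir.
have FF : ProperFilter (filter_from F id).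
  apply: filter_from_proper; last by move=> S /FS[].
  exact: filter_from_filter.
have [U [UU FU]] := ultraFilterLemma FF.
pose S (phi : formula L ('I_m + A)) := [set v : 'I_m -> M | sat (env v set_val) phi].
pose q := [set phi | U (S phi)].
have Uex := @filter_ex _ U.
have qc : complete_type q.
  split.
    move=> F1 finF1 F1q.
    have finS : finite_set (S @` F1) by exact: finite_image.
    have : U (\bigcap_(X in [set` fset_set (S @` F1)]) X).
      apply: filter_bigI => X; rewrite in_fset_set // inE => -[phi F1phi <-].
      exact: F1q.
    move=> /Uex[v Hv]; exists v => phi F1phi.
    have := Hv (S phi); apply; rewrite /= in_fset_set // inE.
    by exists phi.
  by move=> phi; apply: (in_ultra_setVsetC (S phi)).
have [v Hv] := satM A m (Types qc) KA.
exists v => X FX; have [[phi Hphi] _] := FS _ FX.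
apply/Hphi; apply: Hv => /=; rewrite /q /=.
have -> : S phi = X by apply/seteqP; split=> w /=; rewrite /S /= -?Hphi // Hphi.
by apply: FU; exists X.
Qed.

Lemma saturated_directed (K : Type) (L : language) (M : structure L)
    (A : set M) (I : finType) (F : set (set (I -> M))) :
  saturated K M -> small K A -> F !=set0 ->
  (forall S, F S -> definable_with A S /\ S !=set0) ->
  (forall S1 S2, F S1 -> F S2 -> exists2 S3, F S3 & S3 `<=` S1 `&` S2) ->
  exists v, forall S, F S -> S v.
Proof.
move=> satM KA [S0 FS0] FS Fdir.
pose tr (S : set (I -> M)) : set ('I_#|I| -> M) :=
  [set v : 'I_#|I| -> M | S (v \o enum_rank)].
have [|||v Hv] := @saturated_ord_directed K L M A #|I| (tr @` F) satM KA.
- by exists (tr S0), S0.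
- move=> _ [S /FS[HS [v Sv]] <-]; split; first exact: definable_with_reindex.
  exists (v \o enum_val); rewrite /tr /=.
  suff -> : (v \o enum_val) \o enum_rank = v by [].
  by apply/funext => i /=; rewrite enum_rankK.
- move=> _ _ [S1 F1 <-] [S2 F2 <-]; have [S3 F3 S312] := Fdir _ _ F1 F2.
  by exists (tr S3); [exists S3|move=> v /S312].
by exists (v \o enum_rank) => S FSS; apply: (Hv (tr S)); exists S.
Qed.

(** * Type-definable sets *)

Section TypeDefinable.
Context (L : language) (M : structure L) (A : set M).

(** The witness is the set of all formulas implied by one of the S i, which
    avoids choosing a type for each i. *)
Lemma type_definable_forall (V I : Type) (S : I -> set (V -> M)) :
  (forall i, type_definable A (S i)) ->
  type_definable A [set v | forall i, S i v].
Proof.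
move=> HS; exists [set phi | exists i, forall v, S i v -> sat (env v set_val) phi].
apply/seteqP; split=> v /= Hv.
  by move=> phi [i]; apply.
move=> i; have [p Hp] := HS i; rewrite Hp => phi pphi; apply: Hv.
by exists i => w; rewrite Hp; apply.
Qed.

Lemma type_definable_ext (V : Type) (S S' : set (V -> M)) :
  (forall v, S v <-> S' v) -> type_definable A S -> type_definable A S'.
Proof. by move=> SS'; suff -> : S = S' by []; apply/seteqP; split=> v /SS'. Qed.

Lemma type_definable_and (V : Type) (S S' : set (V -> M)) :
  type_definable A S -> type_definable A S' ->
  type_definable A [set v | S v /\ S' v].
Proof.
move=> HS HS'; have := @type_definable_forall V bool (fun b => if b then S else S').
move=> H; apply: type_definable_ext (H _) => {H} [v|[]] //=.
by split=> [H|[Sv S'v] []//]; split; [exact: (H true)|exact: (H false)].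
Qed.

Lemma definable_with_type_definable (V : Type) (S : set (V -> M)) :
  definable_with A S -> type_definable A S.
Proof.
case=> phi H; exists [set phi]; apply/seteqP; split=> v /=.
  by move=> Sv _ ->; apply/H.
by move=> Hv; apply/H/Hv.
Qed.

Lemma type_definable_reindex (V W : Type) (S : set (W -> M)) (h : W -> V) :
  type_definable A S -> type_definable A [set v : V -> M | S (v \o h)].
Proof.
case=> p ->.
have := @type_definable_forall V {phi | p phi}
  (fun phi => [set v : V -> M | sat (env (v \o h) set_val) (sval phi)]).
move=> H; apply: type_definable_ext (H _) => {H} [v|[phi pphi]] /=.
  by split=> [Hv phi pphi|Hv [phi pphi] /=]; [exact: (Hv (exist _ phi pphi))|exact: Hv].
apply: definable_with_type_definable.
have := definable_with_reindex h (definable_with_sat (A := A) (M := M) phi id).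
by [].
Qed.

End TypeDefinable.
(** * Small elementary substructures *)

(** A term denotes a finite sequence of elements, so that the arguments of a
    witness can be combined by a binary node rather than by a list of subterms;
    such trees embed into the formulas of the language by a plain recursion
    ([skolem_code]), which bounds the size of the hull without any cardinal
    arithmetic. *)
Inductive skolem_term (L : language) (J : Type) : Type :=
| SkNil
| SkConst of J
| SkCat of skolem_term L J & skolem_term L J
| SkWitness of formula L nat & skolem_term L J.

Arguments SkNil {L J}.
Arguments SkConst {L J}.

(** Variable 0 of phi is the one to be witnessed and variable i + 1 is the i-th
    argument; d0 is the value when there is no witness. *)
Definition witness (L : language) (M : structure L) (d0 : M)
    (phi : formula L nat) (s : seq M) : M :=
  xget (d0 : {classic M}) [set d | sat (nth d0 (d :: s)) phi].

Fixpoint skolem_eval (L : language) (M : structure L) (J : Type) (d0 : M)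
    (c : J -> M) (t : skolem_term L J) : seq M :=
  match t with
  | SkNil => [::]
  | SkConst j => [:: c j]
  | SkCat t1 t2 => skolem_eval d0 c t1 ++ skolem_eval d0 c t2
  | SkWitness phi t => [:: witness d0 phi (skolem_eval d0 c t)]
  end.

Fixpoint skolem_code (L : language) (J : Type) (code : J -> formula L nat)
    (t : skolem_term L J) : formula L nat :=
  match t with
  | SkNil => Eq (Var L 0%N) (Var L 0%N)
  | SkConst j => Not (Not (code j))
  | SkCat t1 t2 => Or (skolem_code code t1) (skolem_code code t2)
  | SkWitness phi t => Not (Or phi (skolem_code code t))
  end.

Lemma skolem_code_inj (L : language) (J : Type) (code : J -> formula L nat) :
  injective code -> injective (skolem_code code).
Proof.
move=> inj; elim=> [|j|t1 IH1 t2 IH2|phi t IH] [|j'|u1 u2|phi' u] //=.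
- by case=> /inj ->.
- by case=> /IH1 -> /IH2 ->.
- by case=> -> /IH ->.
Qed.

Section SkolemHull.
Context (L : language) (M : structure L) (J : Type) (d0 : M) (c : J -> M).

(** Only the terms denoting one-element sequences contribute an element. *)
Definition skolem_hull : set M :=
  [set x | exists t : skolem_term L J, skolem_eval d0 c t = [:: x]].

Lemma skolem_hull_const (j : J) : skolem_hull (c j).
Proof. by exists (SkConst j). Qed.

Lemma skolem_hull_small (K : Type) (code : J -> formula L nat) :
  injective code -> small K [set: formula L nat] -> small K skolem_hull.
Proof.
move=> inj KL KH; apply: KL; apply: card_le_trans KH _.
have sub : skolem_hull `<=` range (fun t => head d0 (skolem_eval d0 c t)).
  by move=> x [t Ht]; exists t; rewrite ?Ht.
apply: card_le_trans (subset_card_le sub) _.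
apply: card_le_trans (card_image_le _ _) _.
apply: card_le_trans (card_leT (range (skolem_code code))).
rewrite (card_le_eqr (inj_card_eq _)) // => x y _ _.
exact: skolem_code_inj.
Qed.

Lemma skolem_hull_seq (I : Type) (v : I -> M) (s : seq I) :
  (forall i, skolem_hull (v i)) ->
  exists t : skolem_term L J, skolem_eval d0 c t = map v s.
Proof.
move=> Hv; elim: s => [|i s [t IH]]; first by exists SkNil.
by have [u Hu] := Hv i; exists (SkCat u t); rewrite /= Hu IH.
Qed.

Lemma skolem_hull_witness (I : finType) (phi : formula L (unit + I))
    (v : I -> M) (d : M) :
  (forall i, skolem_hull (v i)) -> sat (env (fun=> d) v) phi ->
  exists2 d', skolem_hull d' & sat (env (fun=> d') v) phi.
Proof.
move=> Hv Hd; have [t Ht] := skolem_hull_seq (enum I) Hv.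
pose psi := fmap (fun z : unit + I =>
  match z with inl _ => 0%N | inr i => (enum_rank i).+1 end) phi.
have Hpsi x : sat (nth d0 (x :: map v (enum I))) psi <-> sat (env (fun=> x) v) phi.
  rewrite sat_fmap; set f := _ \o _; suff -> : f = env (fun=> x) v by [].
  apply/funext => -[[]|i] //.
  change (nth d0 (map v (enum I)) (enum_rank i) = v i).
  by rewrite (nth_map i) ?nth_enum_rank // -cardE ltn_ord.
exists (witness d0 psi (map v (enum I))); last first.
  apply/Hpsi; rewrite /witness; case: xgetP => [y _ //|/(_ d) /= H].
  by exfalso; apply: H; apply/Hpsi.
by exists (SkWitness psi t); rewrite /= Ht.
Qed.

(** The value of a function symbol is the witness of a formula that it alone
    satisfies. *)
Lemma skolem_hull_fun (f : fsym L) (v : 'I_(farity f) -> M) :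
  (forall i, skolem_hull (v i)) -> skolem_hull (finterp f v).
Proof.
move=> Hv.
have [|d' Hd'] := @skolem_hull_witness _
  (Eq (Var L (inl tt)) (App (f := f) (fun i => Var L (inr i)))) v
  (finterp f v) Hv; first by [].
by rewrite /= => <-.
Qed.

Lemma skolem_hull_inhabited : inhabited skolem_hull.
Proof.
have [||d Hd _] := @skolem_hull_witness void
  (Eq (Var L (inl tt)) (Var L (inl tt))) (fun i => match i with end) d0 => //.
by constructor; exact: (SigSub (mem_set Hd)).
Qed.

Definition skolem_structure : structure L :=
  Structure skolem_hull_inhabited
    (fun f (args : 'I_(farity f) -> skolem_hull) =>
       (SigSub (mem_set (skolem_hull_fun (fun i => set_valP (args i))))
         : skolem_hull))
    (fun r (args : 'I_(rarity r) -> skolem_hull) =>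
       rinterp r (fun i => set_val (args i))).

Lemma skolem_structure_eval (V : Type) (v : V -> skolem_structure)
    (t : term L V) :
  set_val (eval v t) = eval (set_val \o v : V -> M) t.
Proof.
elim: t => [x|f args IH] //=; congr finterp; apply/funext => i.
exact: IH.
Qed.

(** The Tarski-Vaught test: the formula under the quantifier has only finitely
    many parameters, and [skolem_hull_witness] applies to finite tuples. *)
Lemma skolem_structure_sat (V : Type) (phi : formula L V) :
  forall v : V -> skolem_structure,
  sat v phi <-> sat (set_val \o v : V -> M) phi.
Proof.
elim: phi => {V} [V s t|V r args|V phi IH|V phi1 IH1 phi2 IH2|V phi IH] v /=.
- rewrite -!skolem_structure_eval; split=> [->//|]; exact: val_inj.
- suff -> : (fun i => set_val (eval v (args i))) =
            (fun i => eval (set_val \o v) (args i)) by [].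
  by apply/funext => i; rewrite -skolem_structure_eval.
- by rewrite IH.
- by rewrite IH1 IH2.
- have E (d : skolem_structure) :
      (set_val \o (oapp v d : option V -> skolem_hull) : option V -> M) =
      oapp (set_val \o v) (set_val d).
    by apply/funext => -[].
  split=> -[d].
    by rewrite IH E => Hd; exists (set_val d).
  have [I [be [psi Hpsi]]] := formula_finite_support phi
    (fun o : option V => if o is Some x then inr x else inl tt).
  have E' x : env (fun=> x) (set_val \o v) \o
     (fun o : option V => if o is Some x then inr x else inl tt) =
     oapp (set_val \o v : V -> M) x by apply/funext => -[].
  rewrite -E' Hpsi => /skolem_hull_witness[i|d' Hd' Hsat].
    exact: set_valP.
  exists (SigSub (mem_set Hd') : skolem_hull); apply/IH; rewrite E -E'.
  by apply/Hpsi.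
Qed.

End SkolemHull.

Lemma small_model_containing (K : Type) (L : language) (M : structure L)
    (J : Type) (c : J -> M) (code : J -> formula L nat) :
  small K [set: formula L nat] -> injective code ->
  exists2 C : set M, small_model K C & forall j, C (c j).
Proof.
move=> KL inj; have [d0] := dom_inhabited M.
exists (skolem_hull d0 c); last exact: skolem_hull_const.
split; first exact: skolem_hull_small inj KL.
exists (skolem_structure d0 c), set_val; split.
  by move=> m phi v _; apply: skolem_structure_sat.
apply/seteqP; split=> [x Hx|_ [x _ <-]]; last exact: set_valP.
by exists (SigSub (mem_set Hx)).
Qed.
(** * Codes of generically stable measures *)

Section InvK.
Context (R : realType).

Lemma inv_k_gt0 k : 0 < inv_k R k.
Proof. by rewrite invr_gt0 ltr0n. Qed.

Lemma inv_k_le k1 k2 : (k1 <= k2)%N -> inv_k R k2 <= inv_k R k1.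
Proof. by move=> k12; rewrite lef_pV2 ?posrE ?ltr0n // ler_nat ltnS. Qed.

Lemma inv_k_small (c e : R) : 0 < e -> exists k, c * inv_k R k <= e.
Proof.
move=> e0; exists (Num.truncn (`|c| / e)).
rewrite ler_pdivrMr ?ltr0n // -ler_pdivrMl //.
apply: le_trans (_ : `|c| / e <= _).
  by rewrite mulrC ler_pM2r ?invr_gt0 // ler_norm.
by apply/ltW; rewrite truncnS_gt.
Qed.

(** How equalities between limits are obtained below: each average is known up
    to a fixed multiple of 1/k. *)
Lemma inv_k_eq0 (c x : R) : (forall k, `|x| <= c * inv_k R k) -> x = 0.
Proof.
move=> H; apply/normr0_eq0/eqP; rewrite eq_le normr_ge0 andbT.
apply/ler_addgt0Pr => e e0; rewrite add0r.
by have [k Hk] := inv_k_small c e0; apply: le_trans (H k) Hk.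
Qed.

End InvK.

Section Average.
Context (R : realType) (U : Type) (l : nat).
Implicit Types (a : 'I_l -> U) (D : set U).

Lemma Av_ge0 a D : 0 <= Av R a D.
Proof. by rewrite divr_ge0. Qed.

Lemma Av_setT a : (0 < l)%N -> Av R a setT = 1.
Proof.
move=> l0; rewrite /Av (_ : #|_| = l); first by rewrite divff // pnatr_eq0 -lt0n.
rewrite -[RHS]card_ord; apply: eq_card => i.
by rewrite [RHS]inE; apply/asboolP.
Qed.

Lemma Av_gt0 a D : 0 < Av R a D -> exists i, D (a i).
Proof.
move=> H; have : (0 < #|[pred i | `[<D (a i)>]]|)%N.
  rewrite lt0n; apply/eqP => E; by move: H; rewrite /Av E mul0r ltxx.
by case/card_gt0P => i; rewrite inE => Di; exists i.
Qed.

End Average.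

Definition pnot (L : language) (n : nat) (phi : pformula L n) :=
  PFormula (Not (body phi)).

Lemma defset_pnot (L : language) (M : structure L) (n : nat)
    (phi : pformula L n) (b : 'I_(ysize phi) -> M) :
  defset (pnot phi) b = ~` defset phi b.
Proof. by []. Qed.

Lemma defset_por (L : language) (M : structure L) (n : nat)
    (phi1 phi2 : pformula L n) (b1 : 'I_(ysize phi1) -> M)
    (b2 : 'I_(ysize phi2) -> M) :
  defset (por phi1 phi2) (joint b1 b2) = defset phi1 b1 `|` defset phi2 b2.
Proof.
apply/seteqP; rewrite /defset /=; split=> x /=; rewrite !sat_fmap;
  set f := env _ _ \o _; set g := env _ _ \o _.
all: have -> : f = env x b1 by apply/funext => -[i|j] //=;
  rewrite /f /= /joint; case: split_ordP => j' // /(congr1 val) /= E;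
    [congr b1; apply/val_inj|have := ltn_ord j; rewrite E ltnNge leq_addr].
all: have -> : g = env x b2 by apply/funext => -[i|j] //=;
  rewrite /g /= /joint; case: split_ordP => j' // /(congr1 val) /= E;
    [have := ltn_ord j'; rewrite -E ltnNge leq_addr|congr b2; apply/val_inj => /=;
     apply/eqP; rewrite -(eqn_add2l (ysize phi1)) E].
all: by [].
Qed.

Lemma definable_with_definable (L : language) (M : structure L) (C : set M)
    (n : nat) (D : set ('I_n -> M)) :
  definable_with C D -> definable D.
Proof.
move=> HD.
have := definable_with_reindex (fun i : 'I_n => inl i : 'I_n + void) HD.
move=> /definable_with_pformula[phi [h Hphi]].
have w0 : void -> M by case.
exists phi, (env w0 set_val \o h); apply/seteqP; split=> x.
  by move=> Dx; apply/Hphi.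
by move=> /Hphi.
Qed.

Lemma defset_definable_with (L : language) (M : structure L) (C : set M)
    (n : nat) (phi : pformula L n) (b : 'I_(ysize phi) -> M) :
  (forall j, C (b j)) -> definable_with C (defset phi b).
Proof.
move=> Cb.
have := definable_with_sat (M := M) (A := C) (body phi) (fun z => match z with
   inl i => inl i | inr j => inr (SigSub (mem_set (Cb j))) end).
apply: definable_with_ext => v; rewrite /defset /=; split; congr sat;
  by apply/funext => -[].
Qed.

Lemma definable_setT (L : language) (M : structure L) (n : nat) :
  definable [set: 'I_n -> M].
Proof. exact: (definable_with_definable (definable_with_const set0 _ True)). Qed.

Section Codes.
Context (R : realType) (L : language) (M : structure L) (n : nat)
  (N : pformula L n -> R -> nat).
Implicit Types (a : code_index N -> M) (phi : pformula L n).

Local Notation Avk a phi k b := (Av R (approx a phi k) (defset phi b)).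

(** The limit of the averages, written as a supremum so that it exists without
    an appeal to completeness for Cauchy sequences: condition (i) says that every
    lower bound Av_k - 2/k is below every upper bound Av_k' + 2/k'. *)
Definition code_value a phi (b : 'I_(ysize phi) -> M) : R :=
  sup (range (fun k => Avk a phi k b - 2 * inv_k R k)).

Lemma code_value_dist a phi b k :
  codes a -> `|Avk a phi k b - code_value a b| <= 2 * inv_k R k.
Proof.
move=> [Ha _].
have ub k1 k2 : Avk a phi k1 b - 2 * inv_k R k1 <= Avk a phi k2 b + 2 * inv_k R k2.
  have h1 := inv_k_gt0 R k1; have h2 := inv_k_gt0 R k2.
  have [k12|/ltnW k21] := leqP k1 k2.
    have := Ha phi _ _ _ b (leqnn k1) k12; rewrite ler_norml => /andP[_].
    by lra.
  have := Ha phi _ _ _ b k21 (leqnn k2); rewrite ler_norml => /andP[_].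
  by lra.
have lb1 : Avk a phi k b - 2 * inv_k R k <= code_value a b.
  apply: ub_le_sup; last by exists k.
  by exists (Avk a phi 0 b + 2 * inv_k R 0) => _ [j _ <-].
have ub1 : code_value a b <= Avk a phi k b + 2 * inv_k R k.
  apply: sup_le_ub; first by exists (Avk a phi 0 b - 2 * inv_k R 0), 0%N.
  by move=> _ [j _ <-].
by rewrite ler_norml; apply/andP; split; lra.
Qed.

Lemma representsP a (mu : set ('I_n -> M) -> R) :
  codes a ->
  (represents a mu <->
   forall phi (b : 'I_(ysize phi) -> M), mu (defset phi b) = code_value a b).
Proof.
move=> Ha; split=> Hmu phi b.
  apply/eqP; rewrite -subr_eq0; apply/eqP/(@inv_k_eq0 R 3) => k.
  have /cvgrPdist_le/(_ _ (inv_k_gt0 R k))[k' _ Hk'] := Hmu phi b.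
  have /= h1 := Hk' _ (leq_maxr k k').
  have h2 := code_value_dist b (maxn k k') Ha.
  have h3 := inv_k_le R (leq_maxl k k').
  move: h1 h2; rewrite !ler_norml => /andP[h1 h1'] /andP[h2 h2'].
  by apply/andP; split; lra.
apply/cvgrPdist_le => e e0; have [k Hk] := inv_k_small 2 e0.
exists k => // k' /= kk'; rewrite Hmu distrC.
apply: le_trans (code_value_dist b k' Ha) _; apply: le_trans Hk.
by rewrite ler_pM2l // inv_k_le.
Qed.

Lemma code_value_ge0 a phi (b : 'I_(ysize phi) -> M) :
  codes a -> 0 <= code_value a b.
Proof.
move=> Ha; apply/ler_addgt0Pr => e e0; have [k Hk] := inv_k_small 2 e0.
have := code_value_dist b k Ha; rewrite ler_norml => /andP[_ h].
by have := Av_ge0 R (approx a phi k) (defset phi b); lra.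
Qed.

(** Condition (ii) costs 3/k, and replacing each of the three averages by its
    limit costs 2/k. *)
Lemma code_value_por a (phi1 phi2 : pformula L n) b1 b2 :
  codes a -> defset phi1 b1 `&` defset phi2 b2 = set0 :> set ('I_n -> M) ->
  code_value a (joint b1 b2 : 'I_(ysize (por phi1 phi2)) -> M) =
  code_value a b1 + code_value a b2.
Proof.
move=> Ha disj; apply/eqP; rewrite -subr_eq0; apply/eqP/(@inv_k_eq0 R 9) => k.
have h := Ha.2 phi1 phi2 k b1 b2 disj.
have h0 := @code_value_dist a (por phi1 phi2) (joint b1 b2) k Ha.
have h1 := code_value_dist b1 k Ha.
have h2 := code_value_dist b2 k Ha.
move: h h0 h1 h2; rewrite !ler_norml.
move=> /andP[h h'] /andP[h0 h0'] /andP[h1 h1'] /andP[h2 h2'].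
by apply/andP; split; lra.
Qed.

Hypothesis N_gt0 : forall phi k, (0 < N phi (inv_k R k))%N.

Lemma code_value_setT a phi (b : 'I_(ysize phi) -> M) :
  codes a -> defset phi b = setT :> set ('I_n -> M) -> code_value a b = 1.
Proof.
move=> Ha bT; apply/esym/eqP; rewrite -subr_eq0; apply/eqP/(@inv_k_eq0 R 2) => k.
by have := code_value_dist b k Ha; rewrite bT Av_setT.
Qed.

(** The two formulas need not be negations of each other, only define
    complementary sets; this is why the value of a code depends on the set and
    not on the formula defining it. *)
Lemma code_value_setC a (phi phi' : pformula L n) b b' :
  codes a -> defset phi' b' = ~` defset phi b :> set ('I_n -> M) ->
  code_value a b + code_value a b' = 1.
Proof.
move=> Ha E; rewrite -code_value_por ?E ?setICr //.
by apply: code_value_setT => //; rewrite defset_por E setUv.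
Qed.

(** Both values are complementary to the one of the negation of phi. *)
Lemma code_value_eq a (phi phi' : pformula L n) b b' :
  codes a -> defset phi b = defset phi' b' :> set ('I_n -> M) ->
  code_value a b = code_value a b'.
Proof.
move=> Ha E; apply: (@addIr _ (code_value a (b : 'I_(ysize (pnot phi)) -> M))).
by rewrite !(@code_value_setC a) // defset_pnot ?E.
Qed.

(** The choice of a formula defining D is immaterial by [code_value_eq]; sets
    that are not definable receive 0. *)
Definition code_measure a (D : set ('I_n -> M)) : R :=
  xget 0 [set r | exists phi (b : 'I_(ysize phi) -> M),
                    D = defset phi b /\ r = code_value a b].

Lemma code_measureE a phi (b : 'I_(ysize phi) -> M) :
  codes a -> code_measure a (defset phi b) = code_value a b.
Proof.
move=> Ha; rewrite /code_measure; case: xgetP => [r _ [phi' [b' [E ->]]]|].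
  by apply: code_value_eq.
by move=> /(_ (code_value a b)); case; exists phi, b.
Qed.

Lemma code_measure_represents a : codes a -> represents a (code_measure a).
Proof. by move=> Ha; apply/(representsP _ Ha) => phi b; rewrite code_measureE. Qed.

Lemma code_measure_keisler a : codes a -> keisler (code_measure a).
Proof.
move=> Ha; split.
- by move=> _ [phi [b ->]]; rewrite code_measureE // code_value_ge0.
- have [phi [b E]] := definable_setT M n.
  by rewrite E code_measureE // code_value_setT.
- move=> _ _ [phi1 [b1 ->]] [phi2 [b2 ->]] disj.
  by rewrite -defset_por !code_measureE // code_value_por.
Qed.

Lemma approx_definable a (C : set M) phi k r :
  (forall q, C (a q)) ->
  definable_with C [set b : 'I_(ysize phi) -> M | Avk a phi k b = r].
Proof.
move=> Ca.
have [_ /(_ r)] := @simple_fun_Av L M C R 'I_(ysize phi) n (N phi (inv_k R k)) phi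
  (fun i j => inr (SigSub (mem_set (Ca (existT _ (phi, k) (i, j)))))) inl.
by apply: definable_with_ext => b.
Qed.

(** If the limit is positive then some average is, and an average is positive
    only when one of the coordinates of the code, all in C, lies in the set. *)
Lemma code_measure_finsat a (C : set M) :
  codes a -> (forall q, C (a q)) -> finsat_in C (code_measure a).
Proof.
move=> Ha Ca _ [phi [b ->]]; rewrite code_measureE // => mu0.
have [k Hk] := @inv_k_small R 4 _ mu0.
have := code_value_dist b k Ha; rewrite ler_norml => /andP[h _].
have [|i Di] := @Av_gt0 R _ _ (approx a phi k) (defset phi b).
  by have := inv_k_gt0 R k; lra.
by exists (approx a phi k i); split=> // j; apply: Ca.
Qed.

Lemma types_open (C : set M) m (theta : formula L ('I_m + C)) :
  open [set p : types C m | type_set p theta].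
Proof.
set S := [set p | _].
exists [set S]; last by rewrite bigcup_set1.
move=> _ ->; apply: finI_from1; by exists theta.
Qed.

Lemma type_set_sat (C : set M) m (p : types C m) (b : 'I_m -> M) theta :
  realizations (type_set p) b -> (type_set p theta <-> sat (env b set_val) theta).
Proof.
move=> Hb; split=> [/Hb//|bt].
have [//|/Hb] := (type_complete p).2 theta.
by case.
Qed.

(** The k-th average depends only on one formula of the type of b over C, so it
    is well-defined and locally constant on types; the value is the uniform
    limit of these locally constant functions. *)
Lemma code_measure_definable (K : Type) a (C : set M) :
  saturated K M -> small K C -> codes a -> (forall q, C (a q)) ->
  definable_over C (code_measure a).
Proof.
move=> satM KC Ha Ca phi.
pose bp p := sval (cid (satM C (ysize phi) p KC)).
have Hbp p : realizations (type_set p) (bp p) by rewrite /bp; case: cid.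
have same (p : types C (ysize phi)) (b b' : 'I_(ysize phi) -> M) :
    realizations (type_set p) b -> realizations (type_set p) b' ->
    code_value a b = code_value a b'.
  move=> Hb Hb'; rewrite /code_value; apply: (congr1 (fun f => sup (range f))).
  apply/funext => k.
  congr (_ - _).
  have [theta Htheta] := approx_definable phi k (Avk a phi k b') Ca.
  apply/Htheta; apply/(type_set_sat theta Hb); apply/(type_set_sat theta Hb').
  by apply/Htheta.
exists (fun p => code_value a (bp p)); last first.
  by move=> b p Hb; rewrite code_measureE //; apply: same Hb.
move=> p; have [_ cvgF] := @cvgrPdist_le R R _ (nbhs p) (nbhs_filter p)
  (fun p => code_value a (bp p)) (code_value a (bp p)).
apply: cvgF => e e0.
have [k Hk] := inv_k_small 4 e0.
have [theta Htheta] := approx_definable phi k (Avk a phi k (bp p)) Ca.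
have : nbhs p [set q : types C (ysize phi) | type_set q theta].
  apply: open_nbhs_nbhs; split; first exact: types_open.
  by apply/(type_set_sat theta (Hbp p)); apply/Htheta.
apply: filterS => q /= /(type_set_sat theta (Hbp q)) /Htheta /= E.
have := code_value_dist (bp p) k Ha; have := code_value_dist (bp q) k Ha.
rewrite E !ler_norml => /andP[h h'] /andP[h1 h1'].
by apply/andP; split; lra.
Qed.

End Codes.
Lemma tmap_can (L : language) (V W : Type) (h : V -> W) (g : W -> V) :
  cancel h g -> cancel (@tmap L V W h) (@tmap L W V g).
Proof.
by move=> hg; elim=> [x|f args IH] /=; [rewrite hg|congr App; apply/funext].
Qed.

(** Hence renaming along an injection with a left inverse loses no information,
    which lets formulas in any countable supply of variables be counted among
    the formulas in nat. *)
Lemma fmap_can (L : language) (V : Type) (phi : formula L V) :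
  forall (W : Type) (h : V -> W) (g : W -> V),
  cancel h g -> fmap g (fmap h phi) = phi.
Proof.
elim: phi => {V} [V s t|V r args|V phi IH|V phi1 IH1 phi2 IH2|V phi IH] W h g hg /=.
- by rewrite !(tmap_can hg).
- by congr Rel; apply/funext => i; rewrite (tmap_can hg).
- by rewrite (IH _ _ _ hg).
- by rewrite (IH1 _ _ _ hg) (IH2 _ _ _ hg).
- by rewrite (IH _ (omap h) (omap g)) // => -[x|] //=; rewrite hg.
Qed.

Section CodesOfMeasures.
Context (K : Type) (R : realType) (L : language) (M : structure L) (n : nat)
  (N : pformula L n -> R -> nat).
Implicit Types (a : code_index N -> M) (phi : pformula L n)
  (mu nu : set ('I_n -> M) -> R).

Local Notation Avk a phi k b := (Av R (approx a phi k) (defset phi b)).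

Definition variable_code (m : nat) (z : 'I_n + 'I_m) : nat :=
  match z with inl i => i | inr j => (n + j)%N end.

(** The left inverse needs a default value, which is why some j0 is given. *)
Lemma variable_code_can (m : nat) (j0 : 'I_n) :
  exists g : nat -> 'I_n + 'I_m, cancel (@variable_code m) g.
Proof.
exists (fun k => if insub k is Some i then inl i
  else if insub (k - n)%N is Some j then inr j else inl j0) => -[i|j] /=.
  by rewrite valK.
by rewrite insubF ?addKn ?valK // ltnNge leq_addr.
Qed.

(** Codes have no more coordinates than there are formulas, so the coordinates
    of a code form a small set. *)
Definition index_code (q : code_index N) : formula L nat :=
  let num k : formula L nat := Eq (Var L k) (Var L k) in
  let phi := (tag q).1 in
  Or (Or (num (ysize phi)) (fmap (@variable_code (ysize phi)) (body phi)))
     (Or (num (tag q).2) (Or (num (tagged q).1) (num (tagged q).2))).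

Lemma index_code_inj : injective index_code.
Proof.
move=> [[[m phi] k] [i j]] [[[m' phi'] k'] [i' j']].
rewrite /index_code /= => -[Em]; case: m' / Em phi' i' => phi' i'.
move=> _ Ephi Ek _; case: k' / Ek i' => i' Ei _ Ej _.
have [g hg] := variable_code_can m j.
have Ephi' : phi = phi' by rewrite -(fmap_can phi hg) Ephi (fmap_can phi' hg).
case: phi' / Ephi' i' Ei Ephi => i' /val_inj -> _.
by move/val_inj: Ej => ->.
Qed.

Hypothesis N_gt0 : forall phi k, (0 < N phi (inv_k R k))%N.

Lemma code_measure_generically_stable (a : code_index N -> M) :
  small K [set: formula L nat] -> saturated K M -> codes a ->
  generically_stable K (code_measure a).
Proof.
move=> KL satM Ha; split; first exact: code_measure_keisler.
have [C smallC Ca] := small_model_containing a KL index_code_inj.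
exists C; split=> //; last exact: code_measure_finsat.
by case: smallC => KC _; exact: code_measure_definable satM KC Ha Ca.
Qed.

Lemma code_value_eq_dist (a a' : code_index N -> M) phi phi' b b' :
  codes a -> codes a' ->
  (code_value a (b : 'I_(ysize phi) -> M) =
   code_value a' (b' : 'I_(ysize phi') -> M) <->
   forall k, `|Avk a phi k b - Avk a' phi' k b'| <= 4 * inv_k R k).
Proof.
move=> Ha Ha'; split=> [E k|H].
  have := code_value_dist b k Ha; have := code_value_dist b' k Ha'.
  rewrite E !ler_norml => /andP[h h'] /andP[h1 h1'].
  by apply/andP; split; lra.
apply/eqP; rewrite -subr_eq0; apply/eqP/(@inv_k_eq0 R 8) => k.
have := code_value_dist b k Ha; have := code_value_dist b' k Ha'; have := H k.
rewrite !ler_norml => /andP[h h'] /andP[h1 h1'] /andP[h2 h2'].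
by apply/andP; split; lra.
Qed.

Lemma code_value_const (a : code_index N -> M) phi (b : 'I_(ysize phi) -> M) r :
  codes a ->
  (code_value a b = r <-> forall k, `|Avk a phi k b - r| <= 2 * inv_k R k).
Proof.
move=> Ha; split=> [<- k|H]; first exact: code_value_dist.
apply/eqP; rewrite -subr_eq0; apply/eqP/(@inv_k_eq0 R 4) => k.
have := code_value_dist b k Ha; have := H k.
rewrite !ler_norml => /andP[h h'] /andP[h1 h1'].
by apply/andP; split; lra.
Qed.

(** Averages that are 4/k-close for all k have the same limit, and averages with
    the same limit are within 2/k + 2/k of each other; so the classes are the
    level sets of the represented measure. *)
Lemma code_class_eq (a a' : code_index N -> M) :
  codes a -> codes a' ->
  (code_class a = code_class a' <->
   forall phi (b : 'I_(ysize phi) -> M), code_value a b = code_value a' b).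
Proof.
have equivP (c c' : code_index N -> M) : codes c -> codes c' ->
    (code_equiv c c' <->
     forall phi (b : 'I_(ysize phi) -> M), code_value c b = code_value c' b).
  move=> Hc Hc'; split=> [E phi b|E phi k b].
    by apply/(code_value_eq_dist b b Hc Hc') => k; apply: E.
  by have /(code_value_eq_dist b b Hc Hc') := E phi b.
move=> Ha Ha'; split=> [E|E].
  have : code_class a a' by rewrite E; split=> //; apply/equivP.
  by case=> _ /(equivP _ _ Ha Ha').
apply/seteqP; split=> c [Hc] /equivP Ec; split=> //; apply/equivP => // phi b.
  by rewrite -E Ec.
by rewrite E Ec.
Qed.

Lemma measure_codeE (a : code_index N -> M) mu :
  codes a -> represents a mu -> measure_code N mu = code_class a.
Proof.
move=> Ha Hmu; rewrite /measure_code; case: xgetP => [c _ [a' [Ha' Hmu'] ->]|].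
  apply/code_class_eq => // phi b.
  by rewrite -((representsP _ Ha).1 Hmu) ((representsP _ Ha').1 Hmu').
by move=> /(_ (code_class a)); case; exists a.
Qed.

(** Conditions (i) and (ii) hold with room to spare for exact 1/k-approximations
    of a finitely additive measure. *)
Lemma generically_stable_code mu :
  approx_lengths K M N -> generically_stable K mu ->
  exists2 a : code_index N -> M, codes a & represents a mu.
Proof.
move=> HN Hmu.
have H (q : pformula L n * nat) :
    exists c : 'I_(N q.1 (inv_k R q.2)) -> 'I_n -> M,
    forall b, `|Av R c (defset q.1 b) - mu (defset q.1 b)| <= inv_k R q.2.
  exact: (HN q.1 _ (inv_k_gt0 R q.2)).2.
have [c Hc] := dependent_choice_fun H.
pose a (q : code_index N) := c (tag q) (tagged q).1 (tagged q).2.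
have Ha phi k b : `|Avk a phi k b - mu (defset phi b)| <= inv_k R k.
  exact: (Hc (phi, k) b).
have codes_a : codes a.
  split=> [phi k k1 k2 b kk1 kk2|phi1 phi2 k b1 b2 disj].
    have := Ha phi k1 b; have := Ha phi k2 b.
    have := inv_k_le R kk1; have := inv_k_le R kk2.
    rewrite !ler_norml => ? ? /andP[h1 h1'] /andP[h2 h2'].
    by apply/andP; split; lra.
  have := Ha (por phi1 phi2) k (joint b1 b2).
  have [[_ _ addmu] _] := Hmu.
  rewrite defset_por addmu //; [|by exists phi1, b1|by exists phi2, b2].
  have := Ha phi1 k b1; have := Ha phi2 k b2.
  rewrite !ler_norml => /andP[h1 h1'] /andP[h2 h2'] /andP[h3 h3'].
  by apply/andP; split; lra.
exists a => //; apply/(representsP _ codes_a) => phi b.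
apply/esym/(code_value_const _ _ codes_a) => k.
by apply: le_trans (Ha phi k b) _; have := inv_k_gt0 R k; lra.
Qed.

Lemma code_measure_same (a : code_index N -> M) mu :
  codes a -> represents a mu -> same_measure (code_measure a) mu.
Proof.
move=> Ha Hmu _ [phi [b ->]].
by rewrite code_measureE // ((representsP _ Ha).1 Hmu).
Qed.

End CodesOfMeasures.
(** * Measures supported on a type-definable set *)

Lemma definableP (L : language) (M : structure L) (n : nat)
    (D : set ('I_n -> M)) : definable D <-> definable_with setT D.
Proof.
split=> [[phi [b ->]]|]; last exact: definable_with_definable.
exact: defset_definable_with.
Qed.

Section Keisler.
Context (R : realType) (L : language) (M : structure L) (n : nat)
  (mu : set ('I_n -> M) -> R) (mu_keisler : keisler mu).
Implicit Types D E : set ('I_n -> M).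

Lemma definable_setI D E : definable D -> definable E -> definable (D `&` E).
Proof. by rewrite !definableP; apply: definable_with_and. Qed.

Lemma definable_setU D E : definable D -> definable E -> definable (D `|` E).
Proof. by rewrite !definableP; apply: definable_with_or. Qed.

Lemma definable_setD D E : definable D -> definable E -> definable (D `\` E).
Proof.
rewrite !definableP => HD HE; apply: definable_with_and => //.
exact: definable_with_not.
Qed.

Lemma keisler_le1 D : definable D -> mu D <= 1.
Proof.
move=> HD; have [mu_ge0 <- addmu] := mu_keisler.
have HC := definable_setD (definable_setT M n) HD.
rewrite -(setUv D) -setTD addmu ?lerDl ?mu_ge0 //.
by rewrite setTD setICr.
Qed.

Lemma keisler_setID D E : definable D -> definable E ->
  mu D = mu (D `&` E) + mu (D `\` E).
Proof.
move=> HD HE; have [_ _ addmu] := mu_keisler.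
rewrite -addmu; [by rewrite setUIDK|exact: definable_setI|exact: definable_setD|].
by rewrite setIACA setICr setI0.
Qed.

Lemma keisler_setI1 D E : definable D -> definable E ->
  mu D = 1 -> mu E = 1 -> mu (D `&` E) = 1.
Proof.
move=> HD HE D1 E1; have [mu_ge0 _ addmu] := mu_keisler.
have le1 := keisler_le1 (definable_setI HD HE).
have split_D := keisler_setID HD HE.
have := keisler_le1 (definable_setU (definable_setD HD HE) HE).
rewrite (addmu _ _ (definable_setD HD HE) HE); last first.
  by rewrite setDE -setIA setICl setI0.
by lra.
Qed.

Lemma keisler_disjoint1 D E : definable D -> definable E ->
  mu D = 1 -> D `&` E = set0 -> mu E = 0.
Proof.
move=> HD HE D1 disj; have [mu_ge0 _ addmu] := mu_keisler.
apply/eqP; rewrite eq_le mu_ge0 // andbT.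
have := keisler_le1 (definable_setU HD HE); rewrite addmu // D1; lra.
Qed.

Context (K : Type) (A : set M) (pG : set (formula L ('I_n + A))).
Hypotheses (K_formula : small K [set: formula L nat])
  (M_saturated : saturated K M) (A_small : small K A)
  (mu_supported : supported pG mu).

(** If mu E were positive, then E would meet every A-definable set of measure 1.
    These sets are closed under intersection, so by compactness over A and the
    parameters of E some point of E lies in all of them, in particular in every
    formula of pG: a point of G in E. *)
Lemma supported_disjoint E :
  definable E -> realizations pG `&` E = set0 -> mu E = 0.
Proof.
move=> HE disj; apply: contrapT => muE.
have [phi [b Eb]] := HE.
pose B := A `|` range b.
have BA : A `<=` B by left.
have HEB : definable_with B E.
  by rewrite Eb; apply: defset_definable_with => j; right; exists j.
have KB : small K B.
  apply: (small_setU_finite K_formula A_small).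
  by apply: finite_image; exact: finite_finset.
pose F := [set X `&` E | X in [set X | definable_with A X /\ mu X = 1]].
have [|||v Hv] := saturated_directed (F := F) M_saturated KB.
- exists (setT `&` E), setT => //; split; first exact: definable_with_const.
  by case: mu_keisler.
- move=> _ [X [HX X1] <-]; split.
    by apply: definable_with_and => //; exact: definable_with_sub HX.
  apply/set0P/eqP => XE; apply: muE; apply: keisler_disjoint1 XE => //.
  exact: definable_with_definable HX.
- move=> _ _ [X1 [HX1 E1] <-] [X2 [HX2 E2] <-].
  exists (X1 `&` X2 `&` E); last by move=> x [[? ?] ?]; split; split.
  exists (X1 `&` X2) => //; split; first exact: definable_with_and.
  by apply: keisler_setI1 => //; apply: definable_with_definable; eassumption.
have [_ Ev] : (setT `&` E) v.
  apply: Hv; exists setT => //; split; first exact: definable_with_const.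
  by case: mu_keisler.
suff : set0 v by [].
rewrite -disj; split=> // theta Htheta.
have [] : ([set x | sat (env x set_val) theta] `&` E) v; last by [].
apply: Hv; exists [set x | sat (env x set_val) theta] => //; split.
  by exists theta.
exact: mu_supported.
Qed.

Lemma supported_eq D1 D2 : definable D1 -> definable D2 ->
  D1 `&` realizations pG = D2 `&` realizations pG -> mu D1 = mu D2.
Proof.
move=> H1 H2 E12; rewrite (keisler_setID H1 H2) (keisler_setID H2 H1) setIC.
congr (_ + _).
have aux (D D' : set ('I_n -> M)) :
    D `&` realizations pG = D' `&` realizations pG ->
    realizations pG `&` (D `\` D') = set0.
  move=> E; rewrite -subset0 => x [Gx [Dx nD'x]].
  have [] : (D' `&` realizations pG) x by rewrite -E.
  by [].
by rewrite !supported_disjoint ?aux //; exact: definable_setD.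
Qed.

(** Frees the relative measure from the choice made in its definition. *)
Lemma relative_measureE D S : definable D -> D `&` realizations pG = S ->
  relative_measure (realizations pG) mu S = mu D.
Proof.
move=> HD DS; rewrite /relative_measure; case: xgetP => [D' _ [HD' D'S]|/(_ D)].
  by apply: supported_eq => //; rewrite D'S.
by case.
Qed.

End Keisler.

Lemma relative_measure_same (R : realType) (L : language) (M : structure L)
    (n : nat) (G S : set ('I_n -> M)) (mu nu : set ('I_n -> M) -> R) :
  same_measure mu nu -> relative_measure G mu S = relative_measure G nu S.
Proof.
move=> E; rewrite /relative_measure; apply: E.
case: xgetP => [D _ []//|_].
exact: (definable_with_definable (definable_with_const set0 _ False)).
Qed.

(** * Multiplication by a type-definable operation *)

Section Operation.
Context (K : Type) (L : language) (M : structure L) (A : set M) (n : nat)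
  (G : set ('I_n -> M)) (op : ('I_n -> M) -> ('I_n -> M) -> ('I_n -> M)).
Hypotheses (M_saturated : saturated K M) (A_small : small K A).

Definition op_graph : set ('I_n + ('I_n + 'I_n) -> M) :=
  [set v : 'I_n + ('I_n + 'I_n) -> M | [/\ G (v \o inl), G (v \o (inr \o inl))
             & v \o (inr \o inr) = op (v \o inl) (v \o (inr \o inl))]].

Hypothesis op_graph_td : type_definable A op_graph.

(** If every formula above the graph allowed two distinct values of z over some
    (g, x), then compactness would give two distinct values satisfying the whole
    type, that is, two products of the same pair.  So some formula defines a
    partial function outright, and on G this function is op. *)
Lemma op_graph_formula : exists gamma : set ('I_n + ('I_n + 'I_n) -> M),
  definable_with A gamma /\ forall g x z, G g -> G x ->
    (gamma (env g (env x z)) <-> z = op g x).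
Proof.
pose h1 (z : 'I_n + ('I_n + 'I_n)) : ('I_n + 'I_n) + ('I_n + 'I_n) :=
  match z with inl i => inl (inl i) | inr (inl i) => inl (inr i)
             | inr (inr i) => inr (inl i) end.
pose h2 (z : 'I_n + ('I_n + 'I_n)) : ('I_n + 'I_n) + ('I_n + 'I_n) :=
  match z with inl i => inl (inl i) | inr (inl i) => inl (inr i)
             | inr (inr i) => inr (inr i) end.
(* amb gamma : the tuples (g, x, z, z') for which gamma holds at (g, x, z) and
   (g, x, z') although z and z' differ *)
pose amb (gamma : set ('I_n + ('I_n + 'I_n) -> M)) :
    set (('I_n + 'I_n) + ('I_n + 'I_n) -> M) :=
  [set v : ('I_n + 'I_n) + ('I_n + 'I_n) -> M | (gamma (v \o h1) /\ gamma (v \o h2)) /\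
           ~ forall i, v (inr (inl i)) = v (inr (inr i))].
pose above := [set gamma : set ('I_n + ('I_n + 'I_n) -> M) |
                definable_with A gamma /\ op_graph `<=` gamma].
have above_T : above setT by split=> //; exact: definable_with_const.
have [[gamma [Hgamma Gsub] amb0]|H] :=
    pselect (exists2 gamma, above gamma & amb gamma = set0).
  exists gamma; split=> // g x z Gg Gx.
  have gop : gamma (env g (env x (op g x))) by apply: Gsub.
  split=> [gz|->//]; apply/funext => i; apply: contrapT => zi.
  suff : amb gamma (env (env g x) (env z (op g x))) by rewrite amb0.
  split; last by move=> /(_ i).
  split.
    by move: gz; congr gamma; apply/funext => -[|[]].
  by move: gop; congr gamma; apply/funext => -[|[]].
exfalso.
have [|||v Hv] := saturated_directed (F := amb @` above) M_saturated A_small.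
- by exists (amb setT), setT.
- move=> _ [gamma Hg <-]; split.
    have [Hgamma _] := Hg.
    apply: definable_with_and.
      by apply: definable_with_and; exact: definable_with_reindex.
    apply: definable_with_not.
    apply: (definable_with_forall_fin (S := fun i =>
      [set v : ('I_n + 'I_n) + ('I_n + 'I_n) -> M |
         v (inr (inl i)) = v (inr (inr i))])) => i.
    exact: definable_with_eq.
  by apply/set0P/eqP => E; apply: H; exists gamma.
- move=> _ _ [g1 [H1 s1] <-] [g2 [H2 s2] <-]; exists (amb (g1 `&` g2)).
    exists (g1 `&` g2) => //; split; first exact: definable_with_and.
    by rewrite subsetI.
  by move=> v [[[? ?] [? ?]] ?].
have in_graph h : (forall gamma, above gamma -> gamma (v \o h)) ->
    op_graph (v \o h).
  move=> Hh; have [p Hp] := op_graph_td; rewrite Hp => phi pphi.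
  have : above [set w | sat (env w set_val) phi].
    by split; [exists phi|rewrite Hp => w; apply].
  exact: Hh.
have /in_graph[_ _ E1] : forall gamma, above gamma -> gamma (v \o h1).
  by move=> gamma Hg; have [|[]] := Hv (amb gamma); first by exists gamma.
have /in_graph[_ _ E2] : forall gamma, above gamma -> gamma (v \o h2).
  by move=> gamma Hg; have [|[]] := Hv (amb gamma); first by exists gamma.
have [|_] := Hv (amb setT); first by exists setT.
apply=> i.
have : (v \o h1) \o (inr \o inr) = (v \o h2) \o (inr \o inr) by rewrite E1 E2.
by move/(congr1 (fun f => f i)).
Qed.

(** psi says that some z satisfies gamma(g, x, z) and phi(z, b); its parameters
    are g, b and the finitely many elements of A that occur in gamma. *)
Lemma op_translate (phi : pformula L n) :
  exists (psi : pformula L n) (h : 'I_(ysize psi) -> ('I_n + 'I_(ysize phi)) + A),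
  forall g b x, G g -> G x ->
    (defset phi b (op g x) <-> defset psi (env (env g b) set_val \o h) x).
Proof.
have [gamma [Hgamma gammaP]] := op_graph_formula.
pose m := ysize phi.
pose k1 (z : 'I_n + ('I_n + 'I_n)) : ('I_n + ('I_n + 'I_m)) + 'I_n :=
  match z with inl i => inl (inr (inl i)) | inr (inl i) => inl (inl i)
             | inr (inr i) => inr i end.
pose k2 (z : 'I_n + 'I_m) : ('I_n + ('I_n + 'I_m)) + 'I_n :=
  match z with inl i => inr i | inr j => inl (inr (inr j)) end.
have HS : definable_with A [set v : ('I_n + ('I_n + 'I_m)) + 'I_n -> M |
    gamma (v \o k1) /\ sat (v \o k2) (body phi)].
  apply: definable_with_and; first exact: definable_with_reindex.
  exact: (definable_with_sat (body phi) (inl \o k2)).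
have [psi [h Hpsi]] := definable_with_pformula (definable_with_exists HS).
exists psi, h => g b x Gg Gx; rewrite -Hpsi /=.
have E1 z : env (env x (env g b)) z \o k1 = env g (env x z).
  by apply/funext => -[|[]].
have E2 z : env (env x (env g b)) z \o k2 = env z b by apply/funext => -[].
split.
  move=> Hphi; exists (op g x); rewrite E1 E2; split=> //.
  exact/gammaP.
by case=> z []; rewrite E1 E2 => /gammaP -> //.
Qed.

End Operation.
(** * Type-definability of the stabilizers *)

Section TypeDefinableCodes.
Context (R : realType) (L : language) (M : structure L) (A : set M) (n : nat)
  (N : pformula L n -> R -> nat).

Local Notation Avk a phi k b := (Av R (approx a phi k) (defset phi b)).

Lemma simple_fun_approx (V : Type) (ra : code_index N -> V)
    (phi : pformula L n) k (be : 'I_(ysize phi) -> V + A) :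
  simple_fun A (fun v : V -> M => Avk (v \o ra) phi k (env v set_val \o be)).
Proof.
exact: (simple_fun_Av R (phi := phi) (fun i j => inl (ra (existT _ (phi, k) (i, j)))) be).
Qed.

Lemma codes_type_definable : type_definable A (@codes R L M n N).
Proof.
have H1 (q : pformula L n * (nat * (nat * nat))) : definable_with A
    [set a : code_index N -> M | (q.2.1 <= q.2.2.1)%N && (q.2.1 <= q.2.2.2)%N ->
     forall b, `|Avk a q.1 q.2.2.1 b - Avk a q.1 q.2.2.2 b| <= 2 * inv_k R q.2.1].
  case: q => phi [k [k1 k2]] /=.
  apply: definable_with_imp.
    exact: (definable_with_const A _ ((k <= k1)%N && (k <= k2)%N)).
  exact: (definable_with_forall (simple_fun_rel
    (fun r s => `|r - s| <= 2 * inv_k R k)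
    (simple_fun_approx (inl : _ -> code_index N + 'I_(ysize phi))
       k1 (inl \o inr))
    (simple_fun_approx (inl : _ -> code_index N + 'I_(ysize phi))
       k2 (inl \o inr)))).
have H2 (q : pformula L n * (pformula L n * nat)) : definable_with A
    [set a : code_index N -> M | forall b1 b2,
      defset q.1 b1 `&` defset q.2.1 b2 = set0 :> set ('I_n -> M) ->
       `|Av R (approx a (por q.1 q.2.1) q.2.2)
              (defset (por q.1 q.2.1) (joint b1 b2)) -
         (Avk a q.1 q.2.2 b1 + Avk a q.2.1 q.2.2 b2)| <= 3 * inv_k R q.2.2].
  case: q => phi1 [phi2 k] /=.
  pose m1 := ysize phi1; pose m2 := ysize phi2.
  pose V := ((code_index N + 'I_m1) + 'I_m2)%type.
  pose ra : code_index N -> V := inl \o inl.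
  pose r1 : 'I_m1 -> V := inl \o inr.
  pose r2 : 'I_m2 -> V := inr.
  suff Hbody : definable_with A [set v : V -> M |
      defset phi1 (v \o r1) `&` defset phi2 (v \o r2) = set0 :> set ('I_n -> M) ->
       `|Av R (approx (v \o ra) (por phi1 phi2) k)
              (defset (por phi1 phi2) (joint (v \o r1) (v \o r2))) -
         (Avk (v \o ra) phi1 k (v \o r1) + Avk (v \o ra) phi2 k (v \o r2))|
           <= 3 * inv_k R k].
    have := definable_with_forall (definable_with_forall Hbody).
    by apply: definable_with_ext => a; split=> H b1 b2; exact: (H b1 b2).
  apply: definable_with_imp.
    have : definable_with A [set w : V + 'I_n -> M |
        sat (env (w \o inr) (w \o (inl \o r1))) (body phi1) /\
        sat (env (w \o inr) (w \o (inl \o r2))) (body phi2)].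
      apply: definable_with_and.
        have := definable_with_sat (M := M) (A := A) (V := V + 'I_n) (body phi1)
          (fun z => match z with inl i => inl (inr i) | inr j => inl (inl (r1 j)) end).
        by apply: definable_with_ext => w; split; congr sat; apply/funext => -[].
      have := definable_with_sat (M := M) (A := A) (V := V + 'I_n) (body phi2)
        (fun z => match z with inl i => inl (inr i) | inr j => inl (inl (r2 j)) end).
      by apply: definable_with_ext => w; split; congr sat; apply/funext => -[].
    move=> /definable_with_exists/definable_with_not.
    apply: definable_with_ext => v /=; split=> [H|H [x]].
      by rewrite -subset0 => x [x1 x2]; apply: H; exists x.
    by move=> x12; suff : set0 x by []; rewrite -H.
  have S0 : simple_fun A (fun v : V -> M => Av R (approx (v \o ra) (por phi1 phi2) k)
       (defset (por phi1 phi2) (joint (v \o r1) (v \o r2)))).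
    have := @simple_fun_approx V ra (por phi1 phi2) k
      (inl \o joint r1 r2 : 'I_(ysize (por phi1 phi2)) -> V + A).
    congr simple_fun; apply/funext => v; congr (Av _ _ (defset _ _)).
    by apply/funext => j /=; rewrite /joint; case: fintype.split.
  have S1 := simple_fun_approx ra k (inl \o r1).
  have S2 := simple_fun_approx ra k (inl \o r2).
  exact: (simple_fun_rel (fun r s => `|r - s| <= 3 * inv_k R k)
    S0 (simple_fun_op (fun r s => r + s) S1 S2)).
have := type_definable_and
  (type_definable_forall (fun q => definable_with_type_definable (H1 q)))
  (type_definable_forall (fun q => definable_with_type_definable (H2 q))).
apply: type_definable_ext => a /=; split=> -[Ha1 Ha2]; split.
- by move=> phi k k1 k2 b k_k1 k_k2; apply: (Ha1 (phi, (k, (k1, k2)))); rewrite k_k1.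
- by move=> phi1 phi2 k b1 b2; apply: (Ha2 (phi1, (phi2, k))).
- by move=> [phi [k [k1 k2]]] /andP[? ?] b; apply: Ha1.
- by move=> [phi1 [phi2 k]]; apply: Ha2.
Qed.

Hypothesis N_gt0 : forall phi k, (0 < N phi (inv_k R k))%N.

(** By finite support each formula of pG is an instance, with parameters in A, of
    a formula to which codes apply; that it has measure 1 is a condition on its
    averages. *)
Lemma supported_type_definable (pG : set (formula L ('I_n + A))) :
  exists2 Z : set (code_index N -> M), type_definable A Z &
  forall a, codes a -> (supported pG (code_measure a) <-> Z a).
Proof.
have w0 : void -> M by case.
have H (theta : formula L ('I_n + A)) :
    exists (psi : pformula L n) (c : 'I_(ysize psi) -> A),
    [set x : 'I_n -> M | sat (env x set_val) theta] = defset psi (set_val \o c).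
  have [|psi [h Hpsi]] := @definable_with_pformula L M A n void
    [set v : 'I_n + void -> M | sat (env (v \o inl) set_val) theta].
    have := definable_with_sat (M := M) (A := A) (V := 'I_n + void) theta
      (fun z => match z with inl i => inl (inl i) | inr c => inr c end).
    by apply: definable_with_ext => v; split; congr sat; apply/funext => -[].
  exists psi, (fun j => match h j with inl x => match x with end | inr c => c end).
  apply/seteqP.
  have -> : set_val \o (fun j => match h j with inl x => match x with end | inr c => c end)
    = env w0 set_val \o h by apply/funext => j /=; case: (h j) => // -[].
  by split=> x; [move=> Hx; apply/Hpsi|move=> /Hpsi].
have [psi /dependent_choice_fun[c Hc]] := dependent_choice_fun H.
exists [set a | forall q : {theta | pG theta} * nat,
   `|Avk a (psi (sval q.1)) q.2 (set_val \o c (sval q.1)) - 1| <= 2 * inv_k R q.2].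
  apply: type_definable_forall => -[[theta Htheta] k] /=.
  apply: definable_with_type_definable.
  have S1 := simple_fun_approx id k (inr \o c theta).
  exact: (simple_fun_rel (fun r _ => `|r - 1| <= 2 * inv_k R k) S1 S1).
move=> a Ha; split=> [Hsupp [[theta Htheta] k] /=|HZ theta Htheta].
  apply: (code_value_const _ _ Ha).1.
  by have := Hsupp _ Htheta; rewrite Hc code_measureE.
rewrite Hc code_measureE //; apply/(code_value_const _ _ Ha) => k.
exact: (HZ (exist _ theta Htheta, k)).
Qed.

End TypeDefinableCodes.

Section Main.
Context (K : Type) (R : realType) (L : language) (M : structure L) (A : set M)
  (n : nat) (pG : set (formula L ('I_n + A))) (N : pformula L n -> R -> nat).
Hypotheses (K_formula : small K [set: formula L nat])
  (M_saturated : saturated K M) (A_small : small K A)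
  (N_lengths : approx_lengths K M N).

Local Notation G := (realizations pG).
Local Notation Avk a phi k b := (Av R (approx a phi k) (defset phi b)).

Let N_gt0 phi k : (0 < N phi (inv_k R k))%N.
Proof. exact: (N_lengths phi (inv_k_gt0 R k)).1. Qed.

Lemma op_fixes_same op g (mu nu : set ('I_n -> M) -> R) :
  same_measure mu nu ->
  same_measure (ltranslate G op g mu) mu ->
  same_measure (ltranslate G op g nu) nu.
Proof.
move=> E H D HD; rewrite -(E D HD) -(H D HD) /ltranslate.
by apply/esym/relative_measure_same.
Qed.

(** The condition cut out on (g, a) is the 4/k-closeness of the averages
    for phi(op g x, b) and phi(x, b), where the first formula is taken from
    [op_translate] and hence does not depend on g, b and a. *)
Lemma op_fixes_type_definable op :
  type_definable A (op_graph G op) ->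
  exists2 Z : set ('I_n + code_index N -> M), type_definable A Z &
  forall g a, G g -> codes a -> supported pG (code_measure a) ->
    (same_measure (ltranslate G op g (code_measure a)) (code_measure a)
       <-> Z (env g a)).
Proof.
move=> Hop; have [tr Htr] := dependent_choice_fun
  (op_translate M_saturated A_small Hop).
have [h Hh] := dependent_choice_fun Htr.
(* the variables g and b of the translated formula, among those of (g, a, b) *)
pose emb (m : nat) (z : ('I_n + 'I_m) + A) : (('I_n + code_index N) + 'I_m) + A :=
  match z with inl (inl i) => inl (inl (inl i)) | inl (inr j) => inl (inr j)
             | inr c => inr c end.
exists [set v : 'I_n + code_index N -> M | forall q : pformula L n * nat, forall b,
   `|Avk (v \o inr) (tr q.1) q.2 (env (env (v \o inl) b) set_val \o h q.1) -
     Avk (v \o inr) q.1 q.2 b| <= 4 * inv_k R q.2].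
  apply: type_definable_forall => -[phi k] /=.
  apply: definable_with_type_definable.
  have S1 := simple_fun_approx (M := M) (inl \o inr) k (@emb _ \o h phi).
  have S2 := simple_fun_approx (M := M) (A := A) (phi := phi)
    (inl \o inr : code_index N -> ('I_n + code_index N) + 'I_(ysize phi))
    k (inl \o inr).
  have := definable_with_forall
    (simple_fun_rel (fun r s => `|r - s| <= 4 * inv_k R k) S1 S2).
  apply: definable_with_ext => v /=.
  have E b : env (env v b) set_val \o (@emb _ \o h phi) =
    env (env (v \o inl) b) set_val \o h phi.
    by apply/funext => j /=; case: (h phi j) => [[]|].
  by split=> H b; move: (H b); rewrite E.
move=> g a Gg Ha Hsupp.
have Hks := code_measure_keisler N_gt0 Ha.
have trE phi b : ltranslate G op g (code_measure a) (defset phi b) =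
    code_value a (env (env g b) set_val \o h phi).
  rewrite /ltranslate -code_measureE //.
  apply: (relative_measureE Hks K_formula M_saturated A_small Hsupp).
    by exists (tr phi), (env (env g b) set_val \o h phi).
  apply/seteqP; split=> x /=.
    by case=> Dx Gx; split=> //; apply/Hh.
  by case=> Gx Dx; split=> //; apply/Hh.
split=> [Hfix [phi k] b /=|HZ _ [phi [b ->]]].
  apply: (code_value_eq_dist _ _ Ha Ha).1.
  rewrite -trE -(code_measureE N_gt0 b Ha); apply: Hfix; by exists phi, b.
rewrite trE code_measureE //; apply/(code_value_eq_dist _ _ Ha Ha) => k.
exact: (HZ (phi, k)).
Qed.

(** The passage from representatives to classes, for any property of (g, mu)
    that depends on mu only as a measure on definable sets.  A class determines
    its measure, so the fiber over [mu] is read off from mu itself; and since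
    every code represents a generically stable measure, [code_measure] provides
    the measure for any representative that satisfies the type. *)
Lemma stabilizer_codes_type_definable
    (fixes : ('I_n -> M) -> (set ('I_n -> M) -> R) -> Prop)
    (Z : set ('I_n + code_index N -> M)) :
  (forall g mu nu, same_measure mu nu -> fixes g mu -> fixes g nu) ->
  type_definable A Z ->
  (forall g a, G g -> codes a -> supported pG (code_measure a) ->
     (fixes g (code_measure a) <-> Z (env g a))) ->
  exists St : set (('I_n -> M) * set (code_index N -> M)),
    [/\ St `<=` G `*` group_codes K N pG,
        code_type_definable A St
      & forall mu : set ('I_n -> M) -> R,
          generically_stable K mu -> supported pG mu ->
          [set g | St (g, measure_code N mu)] = [set g | G g /\ fixes g mu]].
Proof.
move=> fixes_same Z_td ZP.
pose St := [set gc : ('I_n -> M) * set (code_index N -> M) |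
  G gc.1 /\ exists mu, [/\ generically_stable K mu, supported pG mu,
    gc.2 = measure_code N mu & fixes gc.1 mu]].
have supp_same (mu nu : set ('I_n -> M) -> R) :
    same_measure mu nu -> supported pG mu -> supported pG nu.
  move=> E H theta Htheta; rewrite -E ?H //.
  by apply: (@definable_with_definable _ _ A); exists theta.
have code_same (a : code_index N -> M) mu : codes a -> generically_stable K mu ->
    code_class a = measure_code N mu -> same_measure (code_measure a) mu.
  move=> Ha Hmu; have [c Hc cmu] := generically_stable_code N_lengths Hmu.
  rewrite (measure_codeE Hc cmu) => /(code_class_eq Ha Hc) E.
  apply: code_measure_same => //; apply/(representsP _ Ha) => phi b.
  by rewrite E ((representsP _ Hc).1 cmu).
exists St; split.
- by move=> [g c] [/= Gg [mu [? ? -> _]]]; split=> //; exists mu.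
- have [Y Y_td YP] := supported_type_definable N_gt0 pG.
  have G_td : type_definable A G by exists pG.
  have := type_definable_and
    (type_definable_and
      (type_definable_reindex (inr : _ -> 'I_n + code_index N)
         (codes_type_definable A N))
      (type_definable_reindex (inr : _ -> 'I_n + code_index N) Y_td))
    (type_definable_and
      (type_definable_reindex (inl : _ -> 'I_n + code_index N) G_td) Z_td).
  apply: type_definable_ext => v /=.
  have env_v : env (v \o inl) (v \o inr) = v by apply/funext => -[].
  split=> [[[Ha /(YP _ Ha) Hsupp] [Gg Zv]]|[Ha [/= Gg [mu [Hmu Hsupp E fixmu]]]]].
    split=> //; split=> //; exists (code_measure (v \o inr)); split=> //.
    + exact: code_measure_generically_stable.
    + by apply/esym/measure_codeE => //; exact: code_measure_represents.
    + by apply/ZP => //; rewrite env_v.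
  have same := code_same _ _ Ha Hmu E.
  have same' : same_measure mu (code_measure (v \o inr)).
    by move=> D /same ->.
  have Hsupp' := supp_same _ _ same' Hsupp.
  split; first by split=> //; apply/YP.
  split=> //; rewrite -env_v; apply/ZP => //.
  exact: fixes_same same' fixmu.
- move=> mu Hmu Hsupp; apply/seteqP; split=> g /= [Gg].
    move=> [nu [Hnu _ E fixnu]]; split=> //.
    have [a Ha amu] := generically_stable_code N_lengths Hmu.
    have aE := measure_codeE Ha amu.
    have s1 := code_same _ _ Ha Hmu (esym aE).
    have s2 : same_measure (code_measure a) nu by apply: code_same; rewrite // -aE.
    by apply: fixes_same fixnu => D HD; rewrite -s1 // s2.
  by move=> fixmu; split=> //; exists mu.
Qed.

End Main.

Theorem lemma3p33 (R : realType) (L : language) (T : set (sentence L))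
    (K : Type) (M : structure L) (A : set M) (n : nat)
    (pG : set (formula L ('I_n + A)))
    (mul : ('I_n -> M) -> ('I_n -> M) -> ('I_n -> M))
    (N : pformula L n -> R -> nat) :
  complete_theory T -> NIP T -> monster K T M ->
  small K A -> type_definable_group pG mul ->
  approx_lengths K M N ->
  (exists St : set (('I_n -> M) * set (code_index N -> M)),
    [/\ St `<=` realizations pG `*` group_codes K N pG,
        code_type_definable A St
      & forall mu : set ('I_n -> M) -> R,
          generically_stable K mu -> supported pG mu ->
          [set g | St (g, measure_code N mu)] =
            stab (realizations pG) mul mu]) /\
  (exists St : set (('I_n -> M) * set (code_index N -> M)),
    [/\ St `<=` realizations pG `*` group_codes K N pG,
        code_type_definable A St
      & forall mu : set ('I_n -> M) -> R,
          generically_stable K mu -> supported pG mu ->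
          [set g | St (g, measure_code N mu)] =
            stab2 (realizations pG) mul mu]).
Proof.
move=> _ _ [_ K_formula M_saturated _] A_small [_ _ _ graph_l] N_lengths.
have graph_r : type_definable A (op_graph (realizations pG) (fun g x => mul x g)).
  have := type_definable_reindex (fun z : 'I_n + ('I_n + 'I_n) =>
    match z with inl i => inr (inl i) | inr (inl i) => inl i
               | inr (inr i) => inr (inr i) end) graph_l.
  by apply: type_definable_ext => v; split=> -[].
have [Zl Zl_td ZlP] := op_fixes_type_definable K_formula M_saturated A_small
  N_lengths graph_l.
have [Zr Zr_td ZrP] := op_fixes_type_definable K_formula M_saturated A_small
  N_lengths graph_r.
split.
  have [|St [StG St_td StE]] := stabilizer_codes_type_definable
    (fixes := fun g mu => same_measure (ltranslate (realizations pG) mul g mu) mu)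
    K_formula M_saturated N_lengths _ Zl_td ZlP.
    by move=> g mu nu; exact: op_fixes_same.
  by exists St; split.
pose fixes g (mu : set ('I_n -> M) -> R) :=
  same_measure (ltranslate (realizations pG) mul g mu) mu /\
  same_measure (rtranslate (realizations pG) mul g mu) mu.
have fixes_same g mu nu : same_measure mu nu -> fixes g mu -> fixes g nu.
  move=> E [H1 H2]; split; first exact: op_fixes_same E H1.
  exact: (op_fixes_same (op := fun g x => mul x g) E H2).
have fixesP g (a : code_index N -> M) : realizations pG g -> codes a ->
    supported pG (code_measure a) ->
    (fixes g (code_measure a) <-> Zl (env g a) /\ Zr (env g a)).
  by move=> Gg Ha Hsupp; rewrite -(ZlP g a Gg Ha Hsupp) -(ZrP g a Gg Ha Hsupp).
have [St [StG St_td StE]] := stabilizer_codes_type_definable K_formula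
  M_saturated N_lengths fixes_same (type_definable_and Zl_td Zr_td) fixesP.
exists St; split=> // mu Hmu Hsupp; rewrite StE //.
by apply/seteqP; split=> g /= => [[? []]|[]].
Qed.
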